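(* Suppose that: (i) for every $x\in\chi$, $f_x$ is uniformly bounded and Lipschitz continuous on $Y$ with constant $L_1>0$; (ii) for every $x\in\chi$, $y\in Y$ the noise $\epsilon_x(y)$ is normally distributed with mean $0$ and standard deviation $\sigma_x(y)\in(0,\infty)$, and every $\sigma_x:Y\to\mathbb{R}$ is Lipschitz continuous on $Y$ with constant $L_2>0$; (iii) the errors $\epsilon_{[i]}$ are mutually independent. Let the data be generated by a (dynamic) sequential random sampling rule $\{a^{(t)}\}_t$ for which there is a constant $\lambda_L>0$ with $a^{(t)}(x,y)>\lambda_L$ for all $t$, $x\in\chi$, $y\in Y^\circ$. Then the total decision loss satisfies $$\varpi^{(t)}\to 0\qquad\text{as } t\to\infty.$$
   Context: Setting. $\chi$ is a finite set of decisions; $Y\subset\mathbb{R}^d$ is a bounded set of contexts with interior $Y^\circ$; $f_x:Y\to\mathbb{R}$ is the unknown expected performance of decision $x$. A simulation run at $(x,y)$ returns $\tilde G_x(y)=f_x(y)+\epsilon_x(y)$ with $\epsilon_x(y)$ a random error. The $i$-th run is made at the point $(x_{[i]},y_{[i]})$ and returns $\tilde G_{[i]}=f_{[i]}+\epsilon_{[i]}$, where $f_{[i]}=f_{x_{[i]}}(y_{[i]})$ and $\epsilon_{[i]}$ is the error of that run. Write $\gamma_{[i]}=((x_{[i]},y_{[i]}),\tilde G_{[i]})$ and $\mathcal D^{(t)}=(\gamma_{[1]},\dots,\gamma_{[t]})$. Sampling. At each stage $t$ one point $(x_{[t]},y_{[t]})\in\chi\times Y^\circ$ is drawn at random from the distribution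 with density $a^{(t)}(x,y)=p_x^{(t)}f^{(t)}_{Y|x}(y)$, where $p^{(t)}_x>0$ is the probability of sampling decision $x$ at stage $t$, $\sum_{x\in\chi} p_x^{(t)}=1$, and $f^{(t)}_{Y|x}$ is the conditional probability density of $y$ on $Y^\circ$ given $x$; that is, the probability of sampling inside $V\subset\chi\times Y^\circ$ at stage $t$ is $\sum_{x\in\chi}\int_{\{y:(x,y)\in V\}}a^{(t)}(x,y)\,dy$. The function $a^{(t)}$ may be predetermined or may be derived from $\mathcal D^{(t-1)}$, and may differ from stage to stage. Shrinking Neighborhood Estimation (SNE). Fix constants $\xi>0$, $c>0$ and put $r_m=c\,m^{-\xi/d}$, $m=1,2,\dots$. For $x\in\chi$ and a context $y$ let $b_m^{(t)}(x,y)=\{\gamma_{[i]}\in\mathcal D^{(t)}: x_{[i]}=x,\ \|y_{[i]}-y\|<r_m,\ y_{[i]}\in Y^\circ\}$. The $m$-set is activated at stage $t$ if $|b_m^{(t)}(x,y)|\ge m$. Let $\tau_m^{(t)}(x,y)=\min\{t'\le t: |b_m^{(t')}(x,y)|=m\}$ if it is activated at stage $t$, and $\infty$ otherwise. Let $\Psi^{(t)}_{x,y}$ be the largest $m$ with $\tau_m^{(t)}(x,y)<\infty$, and $\tau^{(t)}_{x,y}$ the corresponding value $\tau_m^{(t)}(x,y)$, i.e. the last stage up to $t$ at which a new $m$-set was activated. The neighborhood sample set is $b_{x,y}^{(t)}=b^{(\tau^{(t)}_{x,y})}_{\Psi^{(t)}_{x,y}}(x,y)$, which has $\Psi^{(t)}_{x,y}$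 elements. The estimator is $\hat f_x^{(t)}(y)=\frac{1}{\Psi^{(t)}_{x,y}}\sum_{i:\gamma_{[i]}\in b^{(t)}_{x,y}}\tilde G_{[i]}$. Decision loss. $\hat x^{(t)}(y)=\arg\min_{x\in\chi}\hat f_x^{(t)}(y)$, with one minimizer selected at random if there are several; $x^*(y)=\arg\min_{x\in\chi}f_x(y)$; $f^*(y)=f_{x^*(y)}(y)$; $f^{\dagger(t)}(y)=f_{\hat x^{(t)}(y)}(y)$. For a general metric function $d(\cdot,\cdot)$ (for instance the discrete metric, giving the probability of false selection, or $|u-v|$, giving the expected opportunity cost), the expected decision loss conditioned on $y$ is $\upsilon^{(t)}(y)=E_{\mathcal D^{(t)}}\,d(f^{\dagger(t)}(y),f^*(y))$. $Y$ is equipped with a probability distribution $P_Y$, and the total decision loss is $\varpi^{(t)}=\int_{y\in Y}\upsilon^{(t)}(y)\,dP_Y$.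
   Formalization: Added, as the claim fails otherwise: P_Y gives no mass to points of Y outside the closure of Y°, and d(f_x(y), f_x'(y)) is bounded over x, x', y. Y is Borel; (iii) is read as: given earlier runs and the current point, the error has its normal law. *)

(* Defs.v *)
From HB Require Import structures.
From mathcomp Require Import all_boot all_order all_algebra.
From mathcomp Require Import all_classical all_reals all_analysis.

Set Implicit Arguments.
Unset Strict Implicit.
Unset Printing Implicit Defensive.

Import Order.TTheory GRing.Theory Num.Theory.
Import numFieldNormedType.Exports.

Local Open Scope classical_set_scope.
Local Open Scope ring_scope.

(* R^d is 'rV[R]_d.  The library gives it a topology but no sigma-algebra; it *)
(* gets the one generated by the coordinates, as n.-tuple T does.  It is the  *)
(* Borel sigma-algebra.                                                       *)

Definition rV_display : measure_display -> measure_display.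
Proof. exact. Qed.

Section measurable_rV.
Context {d} {T : sigmaRingType d}.
Variable n : nat.

Let coor (i : 'I_n) (y : 'rV[T]_n) : T := y ord0 i.

Let rV_set0 : g_sigma_preimage coor set0.
Proof. exact: sigma_algebra0. Qed.

Let rV_setC A : g_sigma_preimage coor A -> g_sigma_preimage coor (~` A).
Proof. exact: sigma_algebraC. Qed.

Let rV_bigcup (F : _^nat) : (forall i, g_sigma_preimage coor (F i)) ->
  g_sigma_preimage coor (\bigcup_i (F i)).
Proof. exact: sigma_algebra_bigcup. Qed.

HB.instance Definition _ := @isMeasurable.Build (rV_display d)
  'rV[T]_n (g_sigma_preimage coor) rV_set0 rV_setC rV_bigcup.

End measurable_rV.

Section rV_measurability.
Context {R : realType}.

Lemma measurable_coor n (i : 'I_n) :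
  measurable_fun [set: 'rV[R]_n] (fun y => y ord0 i).
Proof.
move=> _ B mB; rewrite setTI; apply: sub_sigma_algebra => /=.
rewrite -bigcup_seq/=; exists i => /=; first by rewrite mem_index_enum.
by exists B => //; rewrite setTI.
Qed.

Lemma measurable_fun_rV d (T : measurableType d) n (g : T -> 'rV[R]_n) :
  (forall i, measurable_fun setT (fun w => g w ord0 i)) ->
  measurable_fun setT g.
Proof.
move=> mg _ A mA; rewrite setTI.
suff: <<s \big[setU/set0]_(i < n) preimage_set_system setT
    (fun y : 'rV[R]_n => y ord0 i) measurable >> `<=`
    [set B | measurable (g @^-1` B)] by exact.
apply: smallest_sub.
  split => /=.
  - by rewrite preimage_set0.
  - by move=> B mB; rewrite setTD preimage_setC; exact: measurableC.
  - by move=> F mF; rewrite preimage_bigcup; exact: bigcup_measurable.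
rewrite -bigcup_seq => B [i _] [C mC <-] /=.
rewrite setTI -[X in measurable X]setTI; exact: mg.
Qed.

Definition consrV n (z : R * 'rV[R]_n) : 'rV[R]_n.+1 :=
  row_mx (const_mx z.1 : 'rV_1) z.2.

Definition unconsrV n (y : 'rV[R]_n.+1) : R * 'rV[R]_n :=
  (y ord0 ord0, \row_j y ord0 (lift ord0 j)).

Lemma consrV0 n (z : R * 'rV[R]_n) : consrV z ord0 ord0 = z.1.
Proof.
have -> : ord0 = lshift n (ord0 : 'I_1) by exact: val_inj.
by rewrite [LHS]row_mxEl mxE.
Qed.

Lemma consrVS n (z : R * 'rV[R]_n) j : consrV z ord0 (lift ord0 j) = z.2 ord0 j.
Proof.
have -> : lift ord0 j = rshift 1 j by exact: val_inj.
by rewrite [LHS]row_mxEr.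
Qed.

Lemma consrVK n : cancel (@consrV n) (@unconsrV n).
Proof.
move=> [s v]; rewrite /unconsrV consrV0/=; congr pair.
by apply/rowP => j; rewrite mxE consrVS.
Qed.

Lemma measurable_consrV n : measurable_fun setT (@consrV n).
Proof.
apply: measurable_fun_rV => i; case: (unliftP ord0 i) => [j|] ->.
  rewrite (_ : (fun _ => _) = (fun y : 'rV[R]_n => y ord0 j) \o snd).
    by apply: measurableT_comp => //; exact: measurable_coor.
  by apply/funext => z /=; rewrite consrVS.
rewrite (_ : (fun _ => _) = fst); first exact: measurable_fst.
by apply/funext => z /=; rewrite consrV0.
Qed.

Lemma measurable_unconsrV n : measurable_fun setT (@unconsrV n).
Proof.
apply: measurable_fun_pair; first exact: measurable_coor.
apply: measurable_fun_rV => i.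
rewrite (_ : (fun _ => _) = (fun y : 'rV[R]_n.+1 => y ord0 (lift ord0 i))).
  exact: measurable_coor.
by apply/funext => y; rewrite mxE.
Qed.

End rV_measurability.

Section lebesgue_step.
Local Open Scope ereal_scope.
Context {R : realType} (n : nat).
Variable mu : {sigma_finite_measure set 'rV[R]_n -> \bar R}.

Definition leb_step : set 'rV[R]_n.+1 -> \bar R :=
  pushforward (@lebesgue_measure R \x mu) (@consrV R n).

Let mconsrV : measurable_fun [set: measurableTypeR R * 'rV[R]_n] (@consrV R n).
Proof. exact: measurable_consrV. Qed.

Let leb0 : leb_step set0 = 0.
Proof. by rewrite /leb_step /pushforward preimage_set0 measure0. Qed.

Let leb_ge0 A : 0 <= leb_step A.
Proof. exact: integral_ge0. Qed.

Let leb_sigma_additive : semi_sigma_additive leb_step.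
Proof.
by apply: measure_semi_sigma_additive => //; exact: mconsrV.
Qed.

HB.instance Definition _ := isMeasure.Build _ _ _ leb_step
  leb0 leb_ge0 leb_sigma_additive.

Let leb_sigma_finite : sigma_finite setT leb_step.
Proof.
have /sigma_finiteP[F [FT ndF Foo]] := sigma_finiteT (@lebesgue_measure R).
have /sigma_finiteP[G [GT ndG Goo]] := sigma_finiteT mu.
exists (fun k => @unconsrV R n @^-1` (F k `*` G k)).
  rewrite -preimage_bigcup (_ : \bigcup_k (F k `*` G k) = setT) ?preimage_setT//.
  apply/seteqP; split => // -[s v] _.
  have [k _ Fk] : (\bigcup_k F k) s by rewrite -FT.
  have [l _ Gl] : (\bigcup_k G k) v by rewrite -GT.
  exists (maxn k l) => //; split.
    by move: (s) Fk; exact/subsetPset/ndF/leq_maxl.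
  by move: (v) Gl; exact/subsetPset/ndG/leq_maxr.
move=> k; have [mF Fk] := Foo k; have [mG Gk] := Goo k; split.
  rewrite -[X in measurable X]setTI; apply: measurable_unconsrV => //.
  exact: measurableX.
rewrite /leb_step /pushforward -comp_preimage.
rewrite (_ : _ \o _ = id); last by apply/funext => z; exact: consrVK.
by rewrite preimage_id product_measure1E// lte_mul_pinfty// ge0_fin_numE.
Qed.

HB.instance Definition _ := Measure_isSigmaFinite.Build _ _ _ leb_step
  leb_sigma_finite.

End lebesgue_step.

Fixpoint lebesgue_rV {R : realType} (n : nat) :
    {sigma_finite_measure set 'rV[R]_n -> \bar R} :=
  match n with
  | 0 => @dirac _ 'rV[R]_0 0 R
  | n'.+1 => leb_step (@lebesgue_rV R n')
  end.

Lemma lebesgue_rV_box (R : realType) n (A : 'I_n -> set R) :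
  (forall i, measurable (A i)) ->
  lebesgue_rV n [set y : 'rV[R]_n | forall i, A i (y ord0 i)] =
  (\prod_(i < n) lebesgue_measure (A i))%E.
Proof.
elim: n A => [|n IH] A mA.
  by rewrite big_ord0 /= diracE mem_set//= => -[].
pose B := [set y : 'rV[R]_n | forall i, A (lift ord0 i) (y ord0 i)].
have mB : measurable B.
  rewrite (_ : B = \bigcap_(i in [set: 'I_n])
      ((fun y : 'rV[R]_n => y ord0 i) @^-1` A (lift ord0 i))).
    apply: fin_bigcap_measurable => [|i _]; first exact: finite_finset.
    by rewrite -[X in measurable X]setTI; exact: measurable_coor.
  by apply/seteqP; split => y /= h => [i _|i]; exact: h.
rewrite big_ord_recl -(IH (fun i => A (lift ord0 i)))//= /leb_step /pushforward.
have -> : @consrV R n @^-1` [set y | forall i, A i (y ord0 i)] = A ord0 `*` B.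
  apply/seteqP; split => -[s v] /=.
    move=> h; split=> [|i]; first by have := h ord0; rewrite consrV0.
    by have := h (lift ord0 i); rewrite consrVS.
  move=> [h0 h] i; case: (unliftP ord0 i) => [j|] ->.
    by rewrite consrVS; exact: h.
  by rewrite consrV0.
rewrite product_measure1E; [by []|exact: mA|exact: mB].
Qed.

Definition euclid_norm (R : realType) (d : nat) (y : 'rV[R]_d) : R :=
  Num.sqrt (\sum_i y ord0 i ^+ 2).

Definition euclid_lipschitz (R : realType) (d : nat) (Y : set 'rV[R]_d) (L : R)
    (g : 'rV[R]_d -> R) : Prop :=
  forall y z, Y y -> Y z -> `|g y - g z| <= L * euclid_norm (y - z).

Definition is_metric (R : realType) (dist : R -> R -> R) : Prop :=
  [/\ forall u v, 0 <= dist u v,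
      forall u v, dist u v = 0 <-> u = v,
      forall u v, dist u v = dist v u
    & forall u v w, dist u w <= dist u v + dist v w].

Definition is_argmin (R : realType) (chi : finType) (g : chi -> R) (x : chi) :
  Prop := forall x', g x <= g x'.

(* One run ((x, y), G): decision, context, simulation output.                 *)
Definition run (R : realType) (chi : finType) (d : nat) : Type :=
  (chi * 'rV[R]_d * R)%type.

Section shrinking_neighborhood_estimation.
Context {R : realType} {chi : finType} {d : nat}.
Variables (Y : set 'rV[R]_d) (c xi : R).

(* A realized infinite sequence of runs; gamma i is run number i.+1, so that  *)
(* the data available after t runs are gamma 0, ..., gamma t.-1.              *)
Variable gamma : nat -> run R chi d.

Definition dataset (t : nat) : seq (run R chi d) := mkseq gamma t.

Definition radius (m : nat) : R := c * m%:R `^ (- (xi / d%:R)).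

Definition nbhd_set (t m : nat) (x : chi) (y : 'rV[R]_d) : {set 'I_t} :=
  [set i : 'I_t | [&& (gamma i).1.1 == x,
                      euclid_norm ((gamma i).1.2 - y) < radius m
                    & `[< Y° (gamma i).1.2 >]]]%SET.

Definition activated (t m : nat) (x : chi) (y : 'rV[R]_d) : bool :=
  (m <= #|nbhd_set t m x y|)%N.

(* None stands for the value oo.  find returns the first t' <= t such that    *)
(* the m-set at stage t' has exactly m elements.                              *)
Definition activation_time (t m : nat) (x : chi) (y : 'rV[R]_d) : option nat :=
  if activated t m x y
  then Some (find (fun t' => #|nbhd_set t' m x y| == m) (iota 0 t.+1))
  else None.

(* The bound m < t.+1 is harmless: an m-set activated at stage t needs at     *)
(* least m runs.  The value is 0 when no m-set (m >= 1) is activated yet.     *)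
Definition Psi (t : nat) (x : chi) (y : 'rV[R]_d) : nat :=
  \max_(m < t.+1 | (0 < m)%N && activation_time t m x y) m.

Definition last_activation (t : nat) (x : chi) (y : 'rV[R]_d) : nat :=
  odflt 0 (activation_time t (Psi t x y) x y).

Definition sample_set (t : nat) (x : chi) (y : 'rV[R]_d) :
    {set 'I_(last_activation t x y)} :=
  nbhd_set (last_activation t x y) (Psi t x y) x y.

(* By the convention 0^-1 = 0 this is 0 while no m-set is activated, where    *)
(* the estimator is otherwise undefined.                                      *)
Definition sne (t : nat) (x : chi) (y : 'rV[R]_d) : R :=
  (Psi t x y)%:R^-1 * \sum_(i in sample_set t x y) (gamma i).2.

End shrinking_neighborhood_estimation.

Section sequential_sampling.
Context {dO : measure_display} {Omega : measurableType dO} {R : realType}.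
Context {chi : finType} {d : nat}.
Variables (P : probability Omega R) (Y : set 'rV[R]_d).
Variables (xs : nat -> Omega -> chi) (ys : nat -> Omega -> 'rV[R]_d).
Variables (eps : nat -> Omega -> R) (f : chi -> 'rV[R]_d -> R).

Definition observed (w : Omega) (i : nat) : run R chi d :=
  ((xs i w, ys i w), f (xs i w) (ys i w) + eps i w).

(* The sigma-algebra generated by the first t runs.                           *)
Definition history (t : nat) : set_system Omega :=
  <<s [set A : set Omega | exists i x (V : set 'rV[R]_d) (B : set R),
         [/\ (i < t)%N, measurable V, measurable B
           & A = [set w | (observed w i).1.1 = x /\ V (observed w i).1.2 /\
                          B (observed w i).2]]] >>.

Definition random_points : Prop :=
  forall i, [/\ forall x, measurable [set w | xs i w = x],
                measurable_fun setT (ys i)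
              & forall w, Y° (ys i w)].

(* A sampling rule gives, from the runs made so far, the probability p of     *)
(* each decision and the conditional density q of the context given the       *)
(* decision; the stage is the length of the list of runs, plus one.           *)
Variables (p : seq (run R chi d) -> chi -> R).
Variables (q : seq (run R chi d) -> chi -> 'rV[R]_d -> R).

Definition density (t : nat) (w : Omega) (x : chi) (y : 'rV[R]_d) : R :=
  let h := dataset (observed w) t in p h x * q h x y.

Definition sampling_rule : Prop := forall t,
  [/\ forall w x, 0 < p (dataset (observed w) t) x,
      forall w, \sum_x p (dataset (observed w) t) x = 1,
      forall w x y, Y° y -> 0 <= q (dataset (observed w) t) x y,
      forall w x, (\int[lebesgue_rV d]_(y in Y°)
                    (q (dataset (observed w) t) x y)%:E)%E = 1%E
    & forall x, measurable_fun setT (fun w => p (dataset (observed w) t) x) /\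
        measurable_fun (setT `*` Y°)
          (fun z : Omega * 'rV[R]_d => q (dataset (observed z.1) t) x z.2)].

(* Conditionally on the first t runs, the next point has density a:           *)
(* P(A and (x_t, y_t) in V) = E[ 1_A sum_x int_{y : (x, y) in V} a(x, y) dy ] *)
(* for every event A of the first t runs.                                     *)
Definition sampled_from_rule : Prop :=
  forall t (A : set Omega) (V : set (chi * 'rV[R]_d)),
    history t A ->
    (forall x, measurable [set y | V (x, y)]) ->
    (forall x y, V (x, y) -> Y° y) ->
    P (A `&` [set w | V (xs t w, ys t w)]) =
    (\int[P]_(w in A)
       \sum_(x : chi) \int[lebesgue_rV d]_(y in [set y | V (x, y)])
         (density t w x y)%:E)%E.

(* N x y is the law of the error of a run made at (x, y).  Independence of    *)
(* the errors means: given the earlier runs and the point of the next run,    *)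
(* the next error has law N at that point.  Unconditional independence would  *)
(* be too strong, since the point may depend on the earlier errors.           *)
Definition independent_errors (N : chi -> 'rV[R]_d -> probability R R) : Prop :=
  (forall t, measurable_fun setT (eps t)) /\
  forall t (A : set Omega) (V : set (chi * 'rV[R]_d)) (B : set R),
    history t A ->
    (forall x, measurable [set y | V (x, y)]) ->
    measurable B ->
    P (A `&` [set w | V (xs t w, ys t w)] `&` [set w | B (eps t w)]) =
    (\int[P]_(w in A `&` [set w | V (xs t w, ys t w)])
       N (xs t w) (ys t w) B)%E.

End sequential_sampling.

Section decision_loss.
Context {dO : measure_display} {Omega : measurableType dO} {R : realType}.
Context {chi : finType} {d : nat}.
Variables (P : probability Omega R) (Y : set 'rV[R]_d).
Variables (PY : probability 'rV[R]_d R).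
Variables (dist : R -> R -> R) (f : chi -> 'rV[R]_d -> R).
Variables (xstar : 'rV[R]_d -> chi) (xhat : nat -> 'rV[R]_d -> Omega -> chi).

Definition expected_loss (t : nat) (y : 'rV[R]_d) : \bar R :=
  ('E_P[fun w => dist (f (xhat t y w) y) (f (xstar y) y)])%E.

Definition total_loss (t : nat) : \bar R :=
  (\int[PY]_(y in Y) expected_loss t y)%E.

End decision_loss.

(* Main.v *)
(* At a context y in the closure of the interior of Y, every stage hits the
   ball of radius r_m around y with decision x with probability at least
   lambda * vol (ball `&` interior Y) > 0, whatever the past.  Hence, for each
   fixed m, the m-set is activated by stage t with probability tending to 1, no
   rate being needed.  When Psi = m, the estimator averages the first m runs
   that hit the ball of radius r_m: its bias is at most L1 * r_m, and since each
   error is Gaussian given the past, an exponential supermartingale bounds the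
   probability that the averaged noise exceeds delta by 2 * rho ^ m with
   rho < 1 independent of m and t.  The m-sets are not nested, but a union bound
   over m >= m0 is a geometric tail, so the estimators converge in probability.
   As chi is finite, xhat is then a true minimizer with probability tending to
   1, so the conditional loss tends to 0 at PY-almost every y.  It may fail to
   be measurable in y; its library integral is then a lower integral, to which
   dominated convergence still applies through simple functions below it. *)

Require Import Defs.
From mathcomp Require Import all_boot all_order all_algebra.
From mathcomp Require Import all_classical all_reals all_analysis.
From mathcomp Require Import measurable_realfun lra ring zify.

Set Implicit Arguments.
Unset Strict Implicit.
Unset Printing Implicit Defensive.

Import Order.TTheory GRing.Theory Num.Theory.
Import numFieldNormedType.Exports.
Import HBNNSimple.

Local Open Scope classical_set_scope.
Local Open Scope ring_scope.

(** * Integrals of nonnegative functions *)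

Section nonnegative_integrals.
Local Open Scope ereal_scope.

(* Unlike the library's [ge0_le_integral], no measurability: for a nonnegative
   function, [integral] is by definition a lower integral. *)
Lemma ge0_le_integral_nonmeasurable d (T : measurableType d) (R : realType)
    (mu : {measure set T -> \bar R}) (D : set T) (f g : T -> \bar R) :
    (forall x, D x -> 0 <= f x) -> (forall x, D x -> f x <= g x) ->
  \int[mu]_(x in D) f x <= \int[mu]_(x in D) g x.
Proof.
move=> f0 fg; have g0 x : D x -> 0 <= g x.
  by move=> Dx; exact: le_trans (f0 _ Dx) (fg _ Dx).
rewrite !ge0_integralE//; apply: le_ereal_sup => _ [h hf <-]; exists h => // x.
by rewrite (le_trans (hf x))// lee_restrict.
Qed.

(* Plays the role of conditioning on the sub-sigma-algebra generated by [G]: an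
   inequality between integrals on its events extends to weights measurable
   with respect to it. *)
Lemma ge0_integral_sub_sigma_le d (T : measurableType d) (R : realType)
    (mu : {measure set T -> \bar R})
    (G : set_system T) (h1 h2 : T -> \bar R) (W : T -> R) :
    <<s G >> `<=` measurable ->
    (forall x, 0 <= h1 x) -> (forall x, 0 <= h2 x) ->
    measurable_fun setT h1 -> measurable_fun setT h2 ->
    (forall A, <<s G >> A ->
       \int[mu]_(x in A) h1 x <= \int[mu]_(x in A) h2 x) ->
    (forall x, (0 <= W x)%R) ->
    measurable_fun setT (W : g_sigma_algebraType G -> R) ->
  \int[mu]_x ((W x)%:E * h1 x) <= \int[mu]_x ((W x)%:E * h2 x).
Proof.
move=> Gm h10 h20 mh1 mh2 h12 W0 mW.
have mEW : measurable_fun setT (EFin \o W : g_sigma_algebraType G -> \bar R).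
  exact/measurable_EFinP.
(* The approximations of [W] are simple for the sub-sigma-algebra, so their level sets are events on
   which [h12] applies. *)
pose g := nnsfun_approx measurableT mEW.
have g0 n x : (0 <= g n x)%R by exact: fun_ge0.
have mg n : measurable_fun setT (g n : T -> R).
  move=> _ B mB; rewrite setTI; apply: Gm.
  have : @measurable _ (g_sigma_algebraType G) (setT `&` g n @^-1` B).
    by apply: (@measurable_funPT _ _ _ _ (g n)).
  by rewrite setTI.
have mgr n r : <<s G >> (g n @^-1` [set r]).
  have : @measurable _ (g_sigma_algebraType G) (g n @^-1` [set r]) by [].
  by [].
have gE h n : (forall x, 0 <= h x) -> measurable_fun setT h ->
    \int[mu]_x ((g n x)%:E * h x) =
    \sum_(r \in range (g n)) r%:E * \int[mu]_(x in g n @^-1` [set r]) h x.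
  move=> h0 mh.
  transitivity (\int[mu]_x \sum_(r \in range (g n))
      (r%:E * (h \_ (g n @^-1` [set r])) x)).
    apply: eq_integral => x _.
    rewrite (fsbigD1 (g n x))//=; last by exists x.
    rewrite patchE mem_set//= fsbig1 ?addr0// => r [_ /= rx].
    by rewrite patchE memNset ?mule0//= => /esym.
  rewrite ge0_integral_fsum//=; last 2 first.
  - move=> r; apply: measurable_funeM.
    apply/(measurable_restrictT _ _).1; first exact: Gm.
    exact: measurable_funTS.
  - move=> r x _; rewrite patchE; case: ifPn => [|_]; last by rewrite mule0.
    by rewrite inE/= => <-; rewrite mule_ge0// lee_fin.
  apply: eq_fsbigr => r; rewrite inE => -[z _ <-].
  rewrite ge0_integralZl//=; first by rewrite -integral_mkcond.
  - apply/(measurable_restrictT _ _).1; first exact: Gm.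
    exact: measurable_funTS.
  - by move=> x _; exact: erestrict_ge0.
  - by rewrite lee_fin.
have lim_g h : (forall x, 0 <= h x) -> measurable_fun setT h ->
    \int[mu]_x ((g n x)%:E * h x) @[n --> \oo] --> \int[mu]_x ((W x)%:E * h x).
  move=> h0 mh.
  have -> : \int[mu]_x ((W x)%:E * h x) =
      \int[mu]_x limn (fun n => (g n x)%:E * h x).
    apply: eq_integral => x _; apply/esym/cvg_lim => //.
    have gW : (g n x)%:E @[n --> \oo] --> (W x)%:E.
      have := @cvg_nnsfun_approx _ _ _ _ measurableT _ mEW _ x Logic.I.
      by apply=> z _; rewrite lee_fin.
    (* Where [W x = 0] and [h x] is infinite, multiplication is not continuous; but the
       approximations, squeezed between 0 and [W], vanish there. *)
    have [Wx0|Wx0] := eqVneq (W x) 0%R; last first.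
      apply: cvgeM => //; last exact: cvg_cst.
      have [hx|hx] := boolP (h x \is a fin_num); first exact: mule_def_fin.
      by apply: mule_def_neq0_infty.
    have gx0 n : g n x = 0%R.
      apply/eqP; rewrite eq_le g0 andbT -Wx0 -lee_fin /g nnsfun_approxE.
      by apply: (@le_approx _ _ _ setT (EFin \o W)) => // z _; rewrite lee_fin.
    rewrite Wx0 mul0e; under eq_fun do rewrite gx0 mul0e.
    exact: cvg_cst.
  apply: cvg_monotone_convergence => //.
  - by move=> n; apply: emeasurable_funM => //; exact/measurable_EFinP.
  - by move=> n x _; rewrite mule_ge0// lee_fin.
  - move=> x _ m n mn; rewrite lee_wpmul2r// lee_fin.
    have /lefP := @nd_nnsfun_approx _ _ _ _ measurableT _ mEW _ _ mn.
    exact.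
apply: (lee_cvg_to (lim_g _ h10 mh1) (lim_g _ h20 mh2)).
apply: nearW => n; rewrite !gE//; apply: lee_fsum => // r [z _ <-].
by rewrite lee_wpmul2l ?lee_fin// h12.
Qed.

(** For simple functions this is linearity together with the mixture identity on level sets. The
    integrand enters only through the simple functions below it. *)
Lemma integral_mixture_le {d d'} (T : measurableType d)
    (U : measurableType d') (R : realType) (mu : {measure set T -> \bar R})
    (nu : {measure set U -> \bar R}) (k : T -> {measure set U -> \bar R})
    (D : set T) (phi : U -> \bar R) (K : \bar R) :
    measurable D ->
    (forall B, measurable B -> measurable_fun D (fun w => k w B)) ->
    (forall B, measurable B -> nu B = \int[mu]_(w in D) k w B)%E ->
    (forall u, 0 <= phi u)%E ->
    (forall w, D w -> \int[k w]_u phi u <= K)%E ->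
  (\int[nu]_u phi u <= K * mu D)%E.
Proof.
move=> mD mk nuE phi0 phiK.
rewrite [leLHS]ge0_integralTE//; apply: ge_ereal_sup => _ [h hphi <-].
have h0 x : (0 <= h x)%R by exact: fun_ge0.
have -> : sintegral nu h = (\int[mu]_(w in D) sintegral (k w) h)%E.
  under eq_integral do rewrite sintegralE.
  rewrite sintegralE ge0_integral_fsum//=.
  - apply: eq_fsbigr => r; rewrite inE => -[z _ <-].
    by rewrite ge0_integralZl ?nuE ?lee_fin//; exact: mk.
  - by move=> r; apply: measurable_funeM; exact: mk.
  - move=> r w _; have [r0|r0] := leP 0%R r; first by rewrite mule_ge0//
    lee_fin.
    rewrite (_ : _ @^-1` _ = set0) ?measure0 ?mule0//.
    by rewrite -subset0 => z /= zr; move: r0; rewrite -zr ltNge h0.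
rewrite -integral_cst//; apply: ge0_le_integral_nonmeasurable => [w Dw|w Dw].
  exact: sintegral_ge0.
apply: le_trans (phiK _ Dw); rewrite [leRHS]ge0_integralTE//.
by apply: ereal_sup_ubound; exists h.
Qed.

Lemma markov_le d (T : measurableType d) (R : realType)
    (mu : {measure set T -> \bar R}) (A : set T) (W : T -> R) (a : R) :
    measurable A -> (0 <= a)%R -> (forall w, 0 <= W w)%R ->
    (forall w, A w -> a <= W w)%R ->
    measurable_fun setT W ->
  a%:E * mu A <= \int[mu]_w (W w)%:E.
Proof.
move=> mA a0 W0 aW mW; rewrite -integral_cst//.
apply: (@le_trans _ _ (\int[mu]_(w in A) (W w)%:E)).
  by apply: ge0_le_integral_nonmeasurable => w Aw; rewrite lee_fin// aW.
apply: ge0_subset_integral => //; first exact/measurable_EFinP.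
by move=> w _; rewrite lee_fin.
Qed.

End nonnegative_integrals.

(** Proved on each simple function below [phi], through its level sets. The map [X] allows the two
    measures to live on different measurable structures over the same points. *)
Lemma ge0_integral_density_le d (T : measurableType d) d'
    (U : measurableType d') (R : realType) (mu : {measure set T -> \bar R})
    (nu : {measure set U -> \bar R}) (X : T -> U) (g : T -> \bar R)
    (phi : U -> \bar R) :
    measurable_fun setT X -> measurable_fun setT g -> (forall x, 0 <= g x)%E ->
    (forall x, 0 <= phi x)%E ->
    (forall B, measurable B -> nu B = \int[mu]_(x in X @^-1` B) g x)%E ->
  (\int[nu]_x phi x <= \int[mu]_x (phi (X x) * g x))%E.
Proof.
move=> mX mg g0 phi0 nuE.
rewrite [leLHS]ge0_integralTE//; apply: ge_ereal_sup => _ [h hphi <-].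
have h0 x : (0 <= h x)%R by exact: fun_ge0.
have mXh r : measurable (X @^-1` (h @^-1` [set r])).
  by rewrite -[X in measurable X]setTI; exact: mX.
apply: (@le_trans _ _ (\int[mu]_x ((h (X x))%:E * g x))%E); last first.
  apply: ge0_le_integral_nonmeasurable => x _;
    first by rewrite mule_ge0// lee_fin.
  by rewrite lee_wpmul2r.
rewrite sintegralE (_ : (\int[mu]_x _)%E = (\int[mu]_x \sum_(r \in range h)
    (r%:E * (g \_ (X @^-1` (h @^-1` [set r]))) x))%E).
  rewrite ge0_integral_fsum//=.
  - apply: lee_fsum => // r [z _ <-].
    rewrite ge0_integralZl//= -?integral_mkcond ?nuE//.
    + by apply/(measurable_restrictT _ _).1 => //; exact: measurable_funTS.
    + by move=> x _; exact: erestrict_ge0.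
    + by rewrite lee_fin.
  - move=> r; apply: measurable_funeM.
    by apply/(measurable_restrictT _ _).1 => //; exact: measurable_funTS.
  - move=> r x _; rewrite patchE; case: ifPn => [|_]; last by rewrite mule0.
    by rewrite inE/= => <-; rewrite mule_ge0// lee_fin.
apply: eq_integral => x _.
rewrite (fsbigD1 (h (X x)))//=; last by exists (X x).
rewrite patchE mem_set//= fsbig1 ?adde0// => r [_ /= rx].
by rewrite patchE memNset ?mule0//= => /esym.
Qed.

(** A lower integral is a supremum over simple functions. Simple functions [h n] below [v n] whose
    integrals fall short by at most [n.+1%:R^-1] are measurable and still tend to 0 off [Z], so
    dominated convergence applies to them. *)
Lemma cvg_integral_nonmeasurable d (T : measurableType d) (R : realType)
    (mu : probability T R) (D Z : set T) (v : nat -> T -> \bar R) (M : R) :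
    measurable Z -> mu Z = 0%E ->
    (forall n x, D x -> 0 <= v n x <= M%:E)%E ->
    (forall x, D x -> ~ Z x -> v n x @[n --> \oo] --> 0%E) ->
  (\int[mu]_(x in D) v n x @[n --> \oo] --> 0)%E.
Proof.
move=> mZ Z0 vM v0.
pose I n := (\int[mu]_(x in D) v n x)%E.
(* The maximum with 0 covers the points outside [D]: the restriction is 0 there, and [M] may be
   negative if [D] is empty. *)
have M0 n x : ((v n \_ D) x <= (Num.max M 0)%:E)%E.
  rewrite patchE; case: ifPn => [|_]; last by rewrite lee_fin le_max lexx orbT.
  by rewrite inE => /(vM n)/andP[_ /le_trans]; apply;
    rewrite lee_fin le_max lexx.
have I0 n : (0 <= I n)%E.
  by apply: integral_ge0 => x /(vM n)/andP[].
have [h hP] : {h : nat -> {nnsfun T >-> R} & forall n,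
    (forall x, ((h n x)%:E <= (v n \_ D) x)%E) /\
    (I n <= sintegral mu (h n) + (n.+1%:R^-1)%:E)%E}.
  apply: (@choice _ _ (fun n (h : {nnsfun T >-> R}) =>
    (forall x, ((h x)%:E <= (v n \_ D) x)%E) /\
    (I n <= sintegral mu h + (n.+1%:R^-1)%:E)%E)) => n.
  (* Only a finite supremum can be approached to within a given positive error. *)
  have Ifin : I n \is a fin_num.
    rewrite ge0_fin_numE//; apply: (@le_lt_trans _ _ (Num.max M 0)%:E) => //;
      last exact: ltry.
    rewrite /I integral_mkcond.
    apply: le_trans.
      apply: (@ge0_le_integral_nonmeasurable _ _ _ _ _ _
          (cst (Num.max M 0)%:E)) => x _.
        by apply: erestrict_ge0 => z /(vM n)/andP[].
      exact: M0.
    rewrite integral_cst// -[leRHS]mule1 lee_wpmul2l ?probability_le1//.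
    by rewrite lee_fin le_max lexx orbT.
  have n0 : 0 < (n.+1%:R^-1 : R) by rewrite invr_gt0.
  move: Ifin; rewrite /I ge0_integralE; last by move=> x /(vM n)/andP[].
  move=> Ifin.
  have [_ [h hv <-] hI] := ub_ereal_sup_adherent n0 Ifin.
  exists h; split=> //.
  by rewrite -leeBlDr//; exact: ltW hI.
have hM n x : (`|(h n x)%:E| <= (Num.max M 0)%:E)%E.
  have [/(_ x) hx _] := hP n.
  by rewrite gee0_abs; [exact: le_trans hx _|rewrite lee_fin].
have h0 : (\int[mu]_x (h n x)%:E @[n --> \oo] --> 0)%E.
  have [|||||_ _] := @dominated_convergence _ _ _ mu setT measurableT
    (fun n x => (h n x)%:E) (cst 0%E) (cst (Num.max M 0)%:E).
  - by move=> n; exact/measurable_EFinP.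
  - exact: measurable_cst.
  - exists Z; split=> // x /=; apply: contra_notP => nZ _.
    have [Dx|nDx] := pselect (D x).
      apply: (@squeeze_cvge _ _ _ _ (cst 0%E) _ (v^~ x)); last 2 first.
      - exact: cvg_cst.
      - exact: v0.
      apply: nearW => n; rewrite lee_fin fun_ge0/=.
      by have [/(_ x)] := hP n; rewrite patchE mem_set.
    rewrite (_ : (fun n => _) = cst 0%E); first exact: cvg_cst.
    apply/funext => n; apply/eqP; rewrite eq_le; apply/andP; split.
      by have [/(_ x)] := hP n; rewrite patchE memNset.
    by rewrite lee_fin.
  - exact: finite_measure_integrable_cst.
  - by apply: aeW => x n _; exact: hM.
  - by rewrite integral0.
apply: (@squeeze_cvge _ _ _ _ (cst 0%E) _
  (fun n => \int[mu]_x (h n x)%:E + (n.+1%:R^-1)%:E)%E); last 2 first.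
- exact: cvg_cst.
- rewrite -[X in _ --> X]adde0; apply: cvgeD => //.
  apply/fine_cvgP; split; first exact: nearW.
  exact: cvg_harmonic.
apply: nearW => n; rewrite I0/=; have [_] := hP n.
by rewrite integral_nnsfun// patch_setT.
Qed.

Lemma measure_bigsetU_le d (T : measurableType d) (R : realType)
    (mu : {measure set T -> \bar R}) (I : Type) (s : seq I) (F : I -> set T) :
  (forall i, measurable (F i)) ->
  (mu (\big[setU/set0]_(i <- s) F i) <= \sum_(i <- s) mu (F i))%E.
Proof.
move=> mF; elim: s => [|i s IH]; first by rewrite !big_nil measure0.
rewrite !big_cons; apply:
  (@le_trans _ _ (mu (F i) + mu (\big[setU/set0]_(i <- s) F i))%E).
  by apply: measureU2 => //; exact: bigsetU_measurable.
by rewrite leeD2l.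
Qed.

Lemma measurable_fun_g_sigma d (T : measurableType d) d' (U : measurableType d')
    (G : set_system T) (W : T -> U) :
  <<s G >> `<=` measurable ->
  measurable_fun setT (W : g_sigma_algebraType G -> U) -> measurable_fun setT W.
Proof.
move=> Gm mW _ B mB; rewrite setTI; apply: Gm.
by have := mW measurableT _ mB; rewrite setTI.
Qed.

(** * Borel sets and Lebesgue measure of row vectors *)

Lemma open_rV_box (R : realType) (n : nat) (U : set 'rV[R]_n) (y : 'rV[R]_n) :
  open U -> U y ->
  exists2 e : R, 0 < e & forall z : 'rV[R]_n, (forall i,
    `|y ord0 i - z ord0 i| < e) -> U z.
Proof.
move=> oU Uy; have /nbhs_ballP[e /= e0 eU] := open_nbhs_nbhs (conj oU Uy).
by exists e => // z yz; apply: eU; split=> // i j; rewrite ord1; exact: yz.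
Qed.

Lemma measurable_rV_box (R : realType) (n : nat) (A : 'I_n -> set R) :
  (forall i, measurable (A i)) ->
  measurable [set y : 'rV[R]_n | forall i, A i (y ord0 i)].
Proof.
move=> mA; rewrite (_ : [set y | _] = \bigcap_(i in [set: 'I_n])
    ((fun y : 'rV[R]_n => y ord0 i) @^-1` A i)).
  apply: fin_bigcap_measurable => [|i _]; first exact: finite_finset.
  by rewrite -[X in measurable X]setTI; exact: measurable_coor.
by apply/seteqP; split => y /= h => [i _|i]; exact: h.
Qed.

(** An open set is the union of the boxes with rational centre and radius that it contains, and
    these are countably many. *)
Lemma open_measurable_rV (R : realType) (n : nat) (U : set 'rV[R]_n) :
  open U -> measurable U.
Proof.
move=> oU.
pose box (a : 'rV[rat]_n * rat) : set 'rV[R]_n :=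
  [set z | forall i, `](ratr (a.1 ord0 i - a.2)),
    (ratr (a.1 ord0 i + a.2))[%classic (z ord0 i)].
have -> : U = \bigcup_(a in [set a | box a `<=` U]) box a.
  apply/seteqP; split => [y Uy|y [a aU]]; last exact: aU.
  have [e e0 eU] := open_rV_box oU Uy.
  (* With the centre within [r] of [y] in each coordinate, the box contains [y] and stays within
     [2 * r < e] of it. *)
  have [r re] := @rat_in_itvoo R 0 (e / 2) ltac:(lra).
  have /choice[q qy] : forall i, exists q : rat,
      ratr q \in `](y ord0 i - ratr r), (y ord0 i + ratr r)[.
    move=> i; have [] :=
      @rat_in_itvoo R (y ord0 i - ratr r) (y ord0 i + ratr r).
      by rewrite ltrD2l gtrN//; case/andP: re.
    by move=> q qy; exists q.
  exists (\row_i q i, r) => /=.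
    move=> z /= hz; apply: eU => i; have := hz i; have := qy i.
    move: re; rewrite !in_itv/= !mxE !raddfD /= raddfN/=.
    rewrite in_itv/= ltr_norml; lra.
  move=> i; have := qy i; rewrite /= !in_itv/= !mxE !raddfD /= raddfN/=
    ?in_itv/=; lra.
rewrite bigcup_mkcond; apply: countable_bigcupT_measurable => [|a].
  exact: countableP.
case: ifPn => // _; apply: (@measurable_rV_box R n (fun i =>
  `](ratr (a.1 ord0 i - a.2)), (ratr (a.1 ord0 i + a.2))[%classic)) => i.
exact: measurable_itv.
Qed.

Lemma euclid_norm0 (R : realType) (n : nat) : euclid_norm (0 : 'rV[R]_n) = 0.
Proof.
by rewrite /euclid_norm big1 ?sqrtr0// => i _; rewrite mxE expr0n.
Qed.

Lemma euclid_normN (R : realType) (n : nat) (y : 'rV[R]_n) :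
  euclid_norm (- y) = euclid_norm y.
Proof.
by rewrite /euclid_norm; under eq_bigr do rewrite mxE sqrrN.
Qed.

Lemma continuous_euclid_norm_sub (R : realType) (n : nat) (y : 'rV[R]_n) :
  continuous (fun z : 'rV[R]_n => euclid_norm (z - y)).
Proof.
move=> z.
have cz i : z' ord0 i @[z' --> z] --> z ord0 i by exact: coord_continuous.
rewrite /continuous_at; move: cz.
have : Filter (nbhs z) by exact: nbhs_filter.
move: (nbhs z) => F FF cz; rewrite /euclid_norm.
apply: continuous_cvg; first exact: sqrt_continuous.
apply: cvg_big => [|i _]; first exact: add_continuous.
under eq_fun do rewrite !mxE expr2.
rewrite !mxE expr2.
have czB : (z' ord0 i - y ord0 i) @[z' --> F] --> z ord0 i - y ord0 i.
  by apply: cvgB; [exact: cz|exact: cvg_cst].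
exact: cvgM.
Qed.

Lemma open_euclid_ball (R : realType) (n : nat) (y : 'rV[R]_n) (r : R) :
  open [set z | euclid_norm (z - y) < r].
Proof.
have /continuousP/(_ _ (@open_lt R r)) := @continuous_euclid_norm_sub R n y.
exact.
Qed.

(** Around each point of [Y] where [g] exceeds [a], the Lipschitz bound gives a ball on whose trace
    in [Y] this persists. Hence the superlevel set is the trace of an open set. *)
Lemma measurable_fun_euclid_lipschitz (R : realType) (n : nat)
    (Y : set 'rV[R]_n) (L : R) (g : 'rV[R]_n -> R) :
  measurable Y -> euclid_lipschitz Y L g -> measurable_fun Y g.
Proof.
move=> mY gL; apply: (measurability (@RGenOInfty.G R)) => [|_ [_ [a ->] <-]].
  exact: RGenOInfty.measurableE.
(* A positive Lipschitz constant whatever the sign of [L], so that the radii below are well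
   defined. *)
have L0 : 0 < `|L| + 1 by have := normr_ge0 L; lra.
pose U := \bigcup_(y in [set y | Y y /\ a < g y])
  [set z | euclid_norm (z - y) < (g y - a) / (`|L| + 1)].
have oU : open U by apply: bigcup_open => y _; exact: open_euclid_ball.
rewrite (_ : _ `&` _ = Y `&` U).
  by apply: measurableI => //; exact: open_measurable_rV.
apply/seteqP; split => z /= [Yz].
  rewrite in_itv/= andbT => az; split=> //; exists z => //=.
  by rewrite subrr euclid_norm0 divr_gt0// subr_gt0.
case=> y [Yy ay] /=; rewrite ltr_pdivlMr// => zy; split=> //;
  rewrite in_itv/= andbT.
have := gL _ _ Yy Yz; rewrite -[y - z]opprB euclid_normN.
have := ler_norm (g y - g z); have := ler_norm L.
have : 0 <= euclid_norm (z - y) by exact: sqrtr_ge0.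
nra.
Qed.

Lemma lebesgue_rV_open_gt0 (R : realType) (n : nat) (U : set 'rV[R]_n) :
  open U -> U !=set0 -> (0 < lebesgue_rV n U)%E.
Proof.
move=> oU [y Uy]; have [e e0 eU] := open_rV_box oU Uy.
pose A i : set R := `]y ord0 i - e, y ord0 i + e[%classic.
have mA i : measurable (A i) by exact: measurable_itv.
apply: (@lt_le_trans _ _ (lebesgue_rV n [set y : 'rV[R]_n | forall i,
  A i (y ord0 i)])).
  rewrite lebesgue_rV_box//.
  apply: (big_ind (fun x : \bar R => 0 < x)%E) => //.
    exact: mule_gt0.
  move=> i _; rewrite /A lebesgue_measure_itv/= lte_fin ltrD2l gtrN//.
  by rewrite -EFinB lte_fin; lra.
apply: le_measure; rewrite ?inE; [exact: measurable_rV_box|exact: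
  open_measurable_rV|].
move=> z Az; apply: eU => i; have := Az i; rewrite /A/= in_itv/= ltr_norml; lra.
Qed.

(** * Normal distributions *)

(* The Borel structures on [R] and on [measurableTypeR R], where [normal_prob]
   lives, are distinct library instances: hence the detour through [nu]. *)
Lemma normal_expR_le (R : realType) (nu : {measure set R -> \bar R})
    (sigma s : R) : 0 < sigma ->
    (forall B, measurable B -> nu B = normal_prob 0 sigma B) ->
  (\int[nu]_e (expR (s * e))%:E <= (expR (s ^+ 2 * sigma ^+ 2 / 2))%:E)%E.
Proof.
move=> sigma0 nuE; have sn0 : sigma != 0 by rewrite gt_eqF.
have mpdf m : measurable_fun setT (fun x : R => (normal_pdf m sigma x)%:E).
  by apply/measurable_EFinP; exact: measurable_normal_pdf.
have pdf0 m x : (0 <= (normal_pdf m sigma x)%:E)%E.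
  by rewrite lee_fin normal_pdf_ge0.
apply: le_trans.
  apply: (@ge0_integral_density_le _ (measurableTypeR R) _ R _ lebesgue_measure
    nu idfun (fun x => (normal_pdf 0 sigma x)%:E)) => //.
    by move=> _ B mB; rewrite setTI.
  exact: mpdf.
(* Completing the square: tilting the centred density by [expR (s * x)] gives a constant times the
   normal density of mean [s * sigma ^+ 2]. *)
under eq_integral => x _.
  rewrite -EFinM (_ : expR (s * x) * normal_pdf 0 sigma x =
      expR (s ^+ 2 * sigma ^+ 2 / 2) * normal_pdf (s * sigma ^+ 2) sigma x).
    rewrite EFinM; over.
  rewrite !normal_pdfE// [LHS]mulrCA [RHS]mulrCA; congr (_ * _).
  rewrite /normal_fun -!expRD; congr expR; field.
  by rewrite sn0.
rewrite ge0_integralZl//; first by rewrite integral_normal_pdf mule1.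
exact: mpdf.
Qed.

(** On positive values the inverse is [expR (- ln g)], a composition of measurable maps. *)
Lemma measurable_fun_inv_gt0 d (T : measurableType d) (R : realType)
    (D : set T) (g : T -> R) :
  measurable_fun D g -> (forall w, D w -> 0 < g w) ->
  measurable_fun D (fun w => (g w)^-1).
Proof.
move=> mg g0; apply: (@eq_measurable_fun _ _ _ _ _ (fun w =>
  expR (- ln (g w)))).
  by move=> w; rewrite inE => /g0 gw0; rewrite expRN lnK.
do 2 apply: measurableT_comp => //.
by apply: measurableT_comp => //; exact: measurable_ln.
Qed.

(** The density is jointly measurable in the parameter and the variable, and Tonelli's theorem makes
    its partial integral measurable. *)
Lemma measurable_fun_normal_prob d (T : measurableType d) (R : realType)
    (D : set T) (sigma : T -> R) (B : set R) :
    measurable D -> measurable_fun D sigma -> (forall w, D w -> 0 < sigma w) ->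
    measurable B ->
  measurable_fun D (fun w => normal_prob 0 (sigma w) B).
Proof.
move=> mD msigma sigma0 mB.
(* Extends [sigma] by 1 outside [D], so that the deviation is positive on the whole space. *)
pose tau w := (sigma \_ D) w + \1_(~` D) w.
have mtau : measurable_fun setT tau.
  apply: measurable_funD; first exact/(measurable_restrictT _ mD).1.
  by apply: measurable_indic; exact: measurableC.
have tauE w : D w -> tau w = sigma w.
  by move=> Dw; rewrite /tau patchE mem_set// indicE memNset//= addr0.
have tau0 w : 0 < tau w.
  have [/[dup] Dw /sigma0|nDw] := pselect (D w); first by rewrite tauE.
  by rewrite /tau patchE memNset// indicE mem_set//= add0r.
pose F (z : T * R) : \bar R :=
  (normal_peak (tau z.1) * normal_fun 0 (tau z.1) z.2 * \1_B z.2)%:E.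
have mF : measurable_fun setT F.
  apply/measurable_EFinP; apply: measurable_funM; last first.
    by apply: measurableT_comp => //; exact: measurable_indic.
  have m1 : measurable_fun setT (fun z : T * R => tau z.1).
    by apply: measurableT_comp.
  apply: measurable_funM.
    apply: measurable_fun_inv_gt0 => [|w _]; last first.
      by rewrite sqrtr_gt0 mulrn_wgt0// mulr_gt0 ?exprn_gt0 ?pi_gt0.
    apply: measurableT_comp.
      by apply: continuous_measurable_fun; exact: sqrt_continuous.
    under eq_fun do rewrite -mulr_natl.
    apply: measurable_funM => //; apply: measurable_funM => //.
    exact: measurable_funX.
  rewrite /normal_fun; apply: measurableT_comp => //=.
  apply: measurable_funM.
    under eq_fun do rewrite subr0.
    by apply: measurableT_comp => //; exact: measurable_funX.
  apply: measurable_fun_inv_gt0 => [|w _]; last by rewrite mulrn_wgt0//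
    exprn_gt0.
  under eq_fun do rewrite -mulr_natl.
  by apply: measurable_funM => //; exact: measurable_funX.
have F0 z : (0 <= F z)%E.
  by rewrite lee_fin !mulr_ge0 ?normal_peak_ge0 ?normal_fun_ge0.
have := measurable_fun_fubini_tonelli_F (m2 := lebesgue_measure) F mF F0.
move=> /(measurable_funS measurableT (@subsetT _ D)).
apply: eq_measurable_fun => w; rewrite inE => Dw.
rewrite /fubini_F /normal_prob [RHS]integral_mkcond; apply: eq_integral => x _.
rewrite /F patchE /= tauE// normal_pdfE ?gt_eqF ?sigma0//.
by rewrite indicE; case: (x \in B); rewrite ?mulr1 ?mulr0.
Qed.

(** * The estimator as an average over the first hits *)

Section first_hits.
Context {R : realType} {chi : finType} {d : nat}.
Variables (Y : set 'rV[R]_d) (c xi : R) (gamma : nat -> run R chi d).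
Variables (x : chi) (y : 'rV[R]_d).

Definition hit (r : R) (i : nat) : bool :=
  [&& (gamma i).1.1 == x, euclid_norm ((gamma i).1.2 - y) < r
    & `[< Y° (gamma i).1.2 >]].

Definition hits (r : R) (t : nat) : nat := \sum_(i < t) hit r i.

(* The runs that enter the [m]-set up to its activation. *)
Definition early (r : R) (m i : nat) : bool := hit r i && (hits r i < m)%N.

Lemma hitsS r t : hits r t.+1 = (hits r t + hit r t)%N.
Proof. by rewrite /hits big_ord_recr. Qed.

Lemma leq_hits r : {homo hits r : s t / (s <= t)%N}.
Proof.
apply: homo_leq => [|n p m|t]; [exact: leqnn|exact: leq_trans|].
by rewrite hitsS leq_addr.
Qed.

Lemma hits_le r t : (hits r t <= t)%N.
Proof.
elim: t => [|t IH]; first by rewrite /hits big_ord0.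
by rewrite hitsS -addn1 leq_add// leq_b1.
Qed.

(** [hits r i] counts the hits strictly before run [i], so [early] selects the first [m] hits, or
    all of them if there are fewer. *)
Lemma sum_early r m t : (\sum_(i < t) early r m i)%N = minn (hits r t) m.
Proof.
elim: t => [|t IH]; first by rewrite /hits !big_ord0 min0n.
rewrite big_ord_recr /= IH hitsS /early; case: (hit r t) => /=;
  last by rewrite !addn0.
by case: ltnP => h; lia.
Qed.

Lemma card_nbhd_set t m : #|nbhd_set Y c xi gamma t m x y| =
  hits (@Defs.radius R d c xi m) t.
Proof. by rewrite cardsE -sum1_card big_mkcond. Qed.

(** [hits_le] puts [m] in the range of the maximum that defines [Psi]. *)
Lemma Psi_ge t m : (m <= hits (@Defs.radius R d c xi m) t)%N ->
  (m <= Psi Y c xi gamma t x y)%N.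
Proof.
case: m => // m mt; have mt' := leq_trans mt (hits_le _ _).
rewrite /Psi; apply: (@leq_bigmax_cond _ _ (fun i : 'I_t.+1 => i : nat)
  (Ordinal (mt' : (m.+1 < t.+1)%N))).
by rewrite /= /activation_time /activated card_nbhd_set mt.
Qed.

(** The maximum is attained: [maxn] returns one of its arguments, and the empty maximum 0 is
    excluded by positivity. *)
Lemma Psi_activated t : (0 < Psi Y c xi gamma t x y)%N ->
  (Psi Y c xi gamma t x y <=
    hits (@Defs.radius R d c xi (Psi Y c xi gamma t x y)) t)%N.
Proof.
rewrite /Psi; elim/big_ind: _ => // [a b IHa IHb|i /andP[_]].
  by rewrite /maxn; case: ifP.
by rewrite /activation_time /activated card_nbhd_set; case: ifP.
Qed.

(** A discrete intermediate value property: the count starts at 0 and grows by at most one per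
    run. *)
Lemma hits_onto r m t : (m <= hits r t)%N -> exists2 s, (s <= t)%N & hits r s =
  m.
Proof.
elim: t => [|t IH mt].
  by rewrite /hits big_ord0 leqn0 => /eqP ->; exists 0%N; rewrite // big_ord0.
have [/IH[s st <-]|tm] := leqP m (hits r t); first by exists s => //;
  exact: ltnW.
by exists t.+1 => //; move: mt; rewrite hitsS; case: (hit r t) => /=; lia.
Qed.

(** Replaces the sum up to a random activation time by one over a fixed range. For a fixed [m], the
    weight of a run depends on the past and on its sampled point but not on its own error, as the
    exponential bounds require. *)
Lemma sneE t (m := Psi Y c xi gamma t x y) : (0 < m)%N ->
  sne Y c xi gamma t x y =
  m%:R^-1 * \sum_(i < t) (early (@Defs.radius R d c xi m) m i)%:R * (gamma i).2.
Proof.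
move=> m0; have mt := Psi_activated m0; rewrite -/m in mt.
rewrite /sne -/m; congr (_ * _).
rewrite /sample_set -/m.
set tau := last_activation Y c xi gamma t x y.
set r := @Defs.radius R d c xi m in mt *.
(* [tau] is the first stage with exactly [m] hits, so every hit before it is early. *)
have [taut tauE taulow] : [/\ (tau <= t)%N, hits r tau = m &
    forall i, (i < tau)%N -> (hits r i < m)%N].
  have Hh i : #|nbhd_set Y c xi gamma i m x y| = hits r i by exact:
    card_nbhd_set.
  have -> : tau = find (fun i => hits r i == m) (iota 0 t.+1).
    rewrite /tau /last_activation /activation_time /activated -/m Hh mt /=.
    by rewrite /= Hh; under eq_find => i do rewrite Hh.
  have [s st sm] := hits_onto mt.
  have hasm : has (fun i => hits r i == m) (iota 0 t.+1).
    by apply/hasP; exists s; [rewrite mem_iota|apply/eqP].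
  set k := find _ _; have kt : (k < t.+1)%N.
    by have := hasm; rewrite has_find size_iota.
  have km : hits r k = m.
    by have := nth_find 0%N hasm; rewrite -/k nth_iota// add0n => /eqP.
  split=> // i ik; rewrite ltn_neqAle -{2}km leq_hits 1?ltnW// andbT.
  have := before_find 0%N ik; rewrite nth_iota ?add0n; first by move=> ->.
  exact: ltn_trans ik kt.
transitivity (\sum_(0 <= i < tau) (early r m i)%:R * (gamma i).2).
  rewrite big_mkord big_mkcond /=; apply: eq_bigr => i _.
  rewrite inE -/(hit r i) /early taulow// andbT.
  by case: (hit r i); rewrite ?mul1r ?mul0r.
rewrite -(big_mkord xpredT (fun i => (early r m i)%:R * (gamma i).2)).
(* From [tau] on the count is already [m], and all weights vanish. *)
rewrite (big_cat_nat _ taut)//= [X in _ = _ + X](_ : _ = 0) ?addr0//.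
rewrite big_nat big1// => i /andP[taui _].
by rewrite /early ltnNge -tauE leq_hits// andbF mul0r.
Qed.

End first_hits.

(** * Conditional bounds for hits and errors *)

Section sequential_bounds.
Context {dO : measure_display} {Omega : measurableType dO} {R : realType}.
Context {chi : finType} {d : nat}.
Variables (Y : set 'rV[R]_d).
Variables (xs : nat -> Omega -> chi) (ys : nat -> Omega -> 'rV[R]_d).
Variables (eps : nat -> Omega -> R) (f : chi -> 'rV[R]_d -> R).
Hypothesis hpoints : random_points Y xs ys.
Hypothesis meps : forall t, measurable_fun setT (eps t).
Hypothesis mf : forall x, measurable_fun Y° (f x).

Local Notation obs := (observed xs ys eps f).

(* [history t] is by definition the sigma-algebra generated by this system. *)
Definition history_gen (t : nat) : set_system Omega :=
  [set A : set Omega | exists i x (V : set 'rV[R]_d) (B : set R),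
     [/\ (i < t)%N, measurable V, measurable B
       & A = [set w | (obs w i).1.1 = x /\ V (obs w i).1.2 /\ B (obs w i).2]]].

Lemma history_measurable t : <<s history_gen t >> `<=` measurable.
Proof.
apply: smallest_sub.
  split => //; first by move=> A mA; rewrite setTD; exact: measurableC.
  by move=> F mF; exact: bigcupT_measurable.
move=> _ [i [x [V [B [_ mV mB ->]]]]] /=.
have [mx my Yy] := hpoints i.
have mg : measurable_fun setT (fun w => f x (ys i w) + eps i w).
  apply: measurable_funD => //.
  apply: (@measurable_comp _ _ _ _ _ _ Y°) => //.
  - by apply: open_measurable_rV; exact: open_interior.
  - by move=> _ [w _ <-]; exact: Yy.
rewrite (_ : [set w | _] = [set w | xs i w = x] `&` (ys i @^-1` V) `&`
    ((fun w => f x (ys i w) + eps i w) @^-1` B)); last first.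
  by apply/seteqP; split => w; rewrite /observed/=;
    [move=> [-> []]|move=> [[->]]].
apply: measurableI; first apply: measurableI => //.
- by rewrite -[X in measurable X]setTI; exact: my.
- by rewrite -[X in measurable X]setTI; exact: mg.
Qed.

Local Notation Th t := (g_sigma_algebraType (history_gen t)).

Lemma history_gen_hit t i x V B : (i < t)%N -> measurable V -> measurable B ->
  measurable ([set w | xs i w = x /\ V (ys i w) /\ B (obs w i).2] : set (Th t)).
Proof.
by move=> it mV mB; apply: sub_sigma_algebra; exists i, x, V, B.
Qed.

Variables (x : chi) (y : 'rV[R]_d) (r : R).

Definition target : set 'rV[R]_d := [set z | euclid_norm (z - y) < r] `&` Y°.

Lemma open_target : open target.
Proof. by apply: openI; [exact: open_euclid_ball|exact: open_interior]. Qed.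

Lemma hitE w i : hit Y (obs w) x y r i = `[< xs i w = x /\ target (ys i w) >].
Proof.
rewrite /hit/=; apply/idP/asboolP; first by case/and3P => /eqP-> ? /asboolP.
by case=> <- [? ?]; apply/and3P; split=> //; apply/asboolP.
Qed.

Lemma measurable_target : measurable target.
Proof. by apply: open_measurable_rV; exact: open_target. Qed.

Definition chi_target : set (chi * 'rV[R]_d) :=
  [set v | v.1 = x /\ target v.2].

Lemma measurable_chi_target z : measurable [set y' | chi_target (z, y')].
Proof.
have [->|zx] := eqVneq z x.
  rewrite (_ : mkset _ = target); first exact: measurable_target.
  by apply/seteqP; split => u /=; [case|].
rewrite (_ : mkset _ = set0)// -subset0 => u /= [/= zx' _].
by rewrite zx' eqxx in zx.
Qed.

Lemma measurable_hit t i : (i < t)%N ->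
  measurable_fun setT (fun w : Th t => (hit Y (obs w) x y r i)%:R : R).
Proof.
move=> it; rewrite (_ : (fun _ => _) = \1_[set w | xs i w =
  x /\ target (ys i w) /\ setT (obs w i).2]).
  apply: measurable_indic; apply: (history_gen_hit x (V := target) (B :=
    setT)) => //.
  by apply: open_measurable_rV; exact: open_target.
apply/funext => w; rewrite indicE hitE; congr (_%:R); congr nat_of_bool.
by apply/asboolP/idP; rewrite inE/=; tauto.
Qed.

(** The history records outputs, not errors; an error is recovered as the output minus the value of
    [f] at the sampled point. *)
Lemma measurable_eps_history t i : (i < t)%N ->
  measurable_fun setT (eps i : Th t -> R).
Proof.
move=> it.
rewrite (_ : eps i = fun w => (obs w i).2 - f (xs i w) (ys i w)); last first.
  by apply/funext => w /=; rewrite addrC addKr.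
(* There are finitely many decisions, so measurability may be checked where the decision is
   fixed. *)
have cover (Q : set Omega) : (forall z, measurable
    ([set w | xs i w = z /\ Q w] : set (Th t))) -> measurable (Q : set (Th t)).
  move=> mQ; rewrite (_ : Q = \bigcup_(z in [set: chi]) [set w | xs i w =
    z /\ Q w]).
    by apply: fin_bigcup_measurable => //; exact: finite_finset.
  by apply/seteqP; split=> [w Qw|w [z _ []]//]; exists (xs i w).
apply: measurable_funB => _ B mB; rewrite setTI; apply: cover => z.
  rewrite (_ : mkset _ = [set w | xs i w =
    z /\ setT (ys i w) /\ B (obs w i).2]).
    exact: (history_gen_hit z (V := setT)).
  by apply/seteqP; split=> w /=; tauto.
(* The sampled context lies in [Y°], so the preimage may be cut down to the set where [f z] is known
   to be measurable. *)
rewrite (_ : mkset _ = [set w | xs i w = z /\ (Y° `&` f z @^-1` B) (ys i w) /\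
    setT (obs w i).2]).
  apply: (history_gen_hit z (V := Y° `&` f z @^-1` B) (B := setT)) => //.
  apply: mf => //.
  by apply: open_measurable_rV; exact: open_interior.
have [_ _ Yy] := hpoints i.
by apply/seteqP; split=> w /= [<-] => [Bf|[[]]]//; do !split.
Qed.

Lemma measurable_hits t i : (i <= t)%N ->
  measurable_fun setT (fun w : Th t => (hits Y (obs w) x y r i)%:R : R).
Proof.
move=> it; under eq_fun do rewrite /hits natr_sum.
apply: measurable_sum => j; apply: measurable_hit.
exact: leq_trans it.
Qed.

Lemma measurable_hits_lt m t i : (i <= t)%N ->
  measurable_fun setT (fun w : Th t => (hits Y (obs w) x y r i < m)%:R : R).
Proof.
move=> it; rewrite (_ : (fun _ => _) = \1_(setT `&`
  (fun w : Th t => (hits Y (obs w) x y r i)%:R) @^-1` `]-oo, (m%:R : R)[)).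
  by apply: measurable_indic; apply: measurable_hits.
apply/funext => w; rewrite indicE setTI; congr (_%:R); congr nat_of_bool.
by apply/idP/idP; rewrite inE/= in_itv/= ltr_nat.
Qed.

Lemma measurable_early m t i : (i < t)%N ->
  measurable_fun setT (fun w : Th t => (early Y (obs w) x y r m i)%:R : R).
Proof.
move=> it; under eq_fun do rewrite /early -mulnb natrM.
apply: measurable_funM; first exact: measurable_hit.
by apply: measurable_hits_lt; exact: ltnW.
Qed.

Local Notation hit_at w i := (hit Y (obs w) x y r i).
Local Notation hits_at w i := (hits Y (obs w) x y r i).
Local Notation early_at m w i := (early Y (obs w) x y r m i).

Variable P : probability Omega R.

Lemma measurable_hit_set t : measurable [set w | hit_at w t].
Proof.
rewrite (_ : mkset _ = setT `&` (fun w => (hit_at w t)%:R : R) @^-1` [set 1]).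
  apply: (@measurable_fun_g_sigma _ _ _ _ (history_gen t.+1)) => //.
    exact: history_measurable.
  exact: measurable_hit.
apply/seteqP; split => w /=; first by move=> ->.
by case: (hit_at w t) => //= -[_ /eqP]; rewrite eq_sym oner_eq0.
Qed.

Lemma hit_setE t :
  [set w | hit_at w t] = [set w | chi_target (xs t w, ys t w)].
Proof. by apply/seteqP; split => w /=; rewrite hitE => /asboolP. Qed.

(** Given the past and a hit, the error is centred normal with deviation at most [K], so its
    exponential moment is at most [expR (s ^+ 2 * K ^+ 2 / 2)]. Integrating over history events
    expresses the conditioning. *)
Lemma noise_step (N : chi -> 'rV[R]_d -> probability R R)
    (sigma : 'rV[R]_d -> R) (s K : R) (t : nat) (A : set Omega) :
    independent_errors P xs ys eps f N ->
    (forall z B, target z -> measurable B -> N x z B =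
      normal_prob 0 (sigma z) B) ->
    measurable_fun target sigma ->
    (forall z, target z -> 0 < sigma z <= K) ->
    <<s history_gen t >> A ->
  (\int[P]_(w in A)
     ((hit_at w t)%:R * expR (s * eps t w - s ^+ 2 * K ^+ 2 / 2))%:E <=
   \int[P]_(w in A) ((hit_at w t)%:R)%:E)%E.
Proof.
move=> [_ hN] Nnormal msigma sigmaK hA.
have mA : measurable A by exact: history_measurable hA.
have mH := measurable_hit_set t.
have mD : measurable (A `&` [set w | hit_at w t]) by exact: measurableI.
set kappa := s ^+ 2 * K ^+ 2 / 2.
have HV := hit_setE t.
have mtarget := measurable_target.
have HD w : (A `&` [set w | hit_at w t]) w -> xs t w = x /\ target (ys t w).
  by rewrite HV => -[].
rewrite [leLHS](_ : _ = \int[P]_(w in A `&` [set w | hit_at w t])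
    (expR (s * eps t w - kappa))%:E)%E; last first.
  rewrite integral_mkcondr; apply: eq_integral => w _; rewrite patchE.
  have [hw|hw] := boolP (w \in [set w | hit_at w t]); first by move: hw;
    rewrite inE /= => ->; rewrite mul1r.
  by move: hw; rewrite notin_setE/= => /negP/negbTE ->; rewrite mul0r.
rewrite [leRHS](_ : _ = 1 * P (A `&` [set w | hit_at w t]))%E; last first.
  rewrite mul1e setIC -(integral_indic _ _ mH)//; apply: eq_integral => w _.
  rewrite indicE; congr ((_ %:R)%:E); congr nat_of_bool.
  by apply/idP/idP; rewrite inE.
have mphi : measurable_fun setT (fun e : R => (expR (s * e - kappa))%:E).
  apply/measurable_EFinP; apply: measurableT_comp => //.
  by apply: measurable_funB => //; exact: measurable_funM.
apply: (@le_trans _ _ (\int[mrestr P mD]_w (expR (s * eps t w - kappa))%:E)%E).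
  rewrite (@eq_measure_integral _ _ _ _ (mrestr P mD)); last first.
    by move=> B mB BD; rewrite /mrestr/=; congr (P _); rewrite setIidl.
  apply: ge0_subset_integral => //.
  exact: (measurableT_comp mphi).
(* The image of the restricted probability under [eps t] is, by [hN], a mixture of normal laws over
   the sampled points of the event; each of them gives the integrand mass at most 1. *)
have -> : (\int[mrestr P mD]_w (expR (s * eps t w - kappa))%:E =
    \int[pushforward (mrestr P mD) (eps t)]_e (expR (s * e - kappa))%:E)%E.
  by rewrite ge0_integral_pushforward.
apply: (@integral_mixture_le _ _ _ _ _ P _ (fun w => N (xs t w) (ys t w))) =>
  //.
- move=> B mB.
  apply: (@eq_measurable_fun _ _ _ _ _ (fun w =>
    normal_prob 0 (sigma (ys t w)) B)).
    by move=> w /[!inE] /HD[xw tw] /=; rewrite xw Nnormal.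
  apply: measurable_fun_normal_prob => //.
    apply: (@measurable_comp _ _ _ _ _ _ target) => //.
      by move=> _ [w /HD[_ tw] <-].
    by apply: measurable_funTS; have [_ my _] := hpoints t.
  by move=> w /HD[_ /sigmaK/andP[]].
- move=> B mB; rewrite /= /pushforward /mrestr HV setIC; apply: hN => //.
  exact: measurable_chi_target.
- move=> w /HD[-> tw]; have /andP[sw0 swK] := sigmaK _ tw.
  under eq_integral do rewrite addrC expRD EFinM.
  rewrite ge0_integralZl//=.
  + apply: (@le_trans _ _ ((expR (- kappa))%:E *
        (expR (s ^+ 2 * sigma (ys t w) ^+ 2 / 2))%:E)%E).
      rewrite lee_wpmul2l ?lee_fin ?expR_ge0//.
      by apply: normal_expR_le => // B mB; exact: Nnormal.
    rewrite -EFinM -expRD lee_fin -[leRHS]expR0 ler_expR /kappa addrC subr_le0.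
    rewrite ler_wpM2r// ler_wpM2l ?sqr_ge0//.
    by rewrite ler_pXn2r// nnegrE ?ltW// (lt_le_trans sw0).
  + by apply/measurable_EFinP; apply: measurableT_comp.
Qed.

(** Whatever the past, the sampling density exceeds [lambda] on the target, so the conditional
    probability of a hit is at least [lambda] times its volume. *)
Lemma hit_step (p : seq (run R chi d) -> chi -> R)
    (q : seq (run R chi d) -> chi -> 'rV[R]_d -> R) (lambda pi0 : R)
    (t : nat) (A : set Omega) :
    sampling_rule Y xs ys eps f p q -> sampled_from_rule P Y xs ys eps f p q ->
    0 < lambda ->
    (forall t w z y', Y° y' -> lambda < density xs ys eps f p q t w z y') ->
    (pi0%:E <= lambda%:E * lebesgue_rV d target)%E -> 0 <= pi0 ->
    <<s history_gen t >> A ->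
  (\int[P]_(w in A) pi0%:E <= \int[P]_(w in A) ((hit_at w t)%:R)%:E)%E.
Proof.
move=> hrule hsampled lambda0 hdensity pi0le pi00 hA.
have mtarget := measurable_target.
have mA : measurable A by exact: history_measurable hA.
have mH := measurable_hit_set t.
rewrite [leRHS](_ : _ = P (A `&` [set w | chi_target (xs t w, ys t w)]));
  last first.
  rewrite -hit_setE setIC -(integral_indic _ _ mH)//; apply: eq_integral => w _.
  rewrite indicE; congr ((_ %:R)%:E); congr nat_of_bool.
  by apply/idP/idP; rewrite inE.
rewrite hsampled//; last 2 first.
- exact: measurable_chi_target.
- by move=> z y' [_ [_]].
apply: ge0_le_integral_nonmeasurable => w _; first by rewrite lee_fin.
apply: (le_trans pi0le).
have dens0 z : (0 <= \int[lebesgue_rV d]_(y0 in [set y0 | chi_target (z, y0)])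
    (density xs ys eps f p q t w z y0)%:E)%E.
  apply: integral_ge0 => y' [_ [_ Yy']]; rewrite lee_fin ltW//.
  by apply: lt_trans (hdensity _ _ _ _ Yy').
(* Only decision [x] can hit; the other terms are merely nonnegative. *)
rewrite (bigD1 x)//= -[leLHS]adde0 leeD//; last exact: sume_ge0.
rewrite (_ : [set y' | chi_target (x, y')] = target); last first.
  by apply/seteqP; split => u /=; [case|].
rewrite -integral_cst//.
apply: ge0_le_integral_nonmeasurable => z [_ Yz]; first by rewrite lee_fin ltW.
by rewrite lee_fin ltW// hdensity.
Qed.

Lemma measurable_hits_lt_set m t : measurable [set w | (hits_at w t < m)%N].
Proof.
rewrite (_ : mkset _ = setT `&` (fun w => (hits_at w t)%:R : R) @^-1` `]-oo,
  (m%:R : R)[).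
  apply: (measurable_fun_g_sigma (@history_measurable t)) => //.
  exact: measurable_hits.
by rewrite setTI; apply/seteqP; split => w /=; rewrite in_itv/= ltr_nat.
Qed.

Lemma few_hits_prob (pi0 : R) (m t : nat) : 0 <= pi0 <= 1 ->
    (forall t A, <<s history_gen t >> A ->
      (\int[P]_(w in A) pi0%:E <= \int[P]_(w in A) ((hit_at w t)%:R)%:E)%E) ->
  (P [set w | (hits_at w t < m)%N] <= (2 ^+ m * (1 - pi0 / 2) ^+ t)%:E)%E.
Proof.
move=> /andP[pi00 pi01] hstep.
(* Given the past, a stage multiplies the mean of [2^-1 ^+ hits] by at most
   [1 - pi0 / 2]; Markov's inequality concludes. *)
pose W t w : R := 2^-1 ^+ (hits_at w t).
have W0 t' w : 0 <= W t' w by rewrite exprn_ge0.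
have mWh t' : measurable_fun setT (W t' : Th t' -> R).
  have -> : W t' = fun w => expR (- ln 2 * (hits_at w t')%:R).
    apply/funext => w; rewrite /W mulrC expRM_natl expRN lnK//.
    by rewrite posrE.
  apply: measurableT_comp => //; apply: measurable_funM => //.
  exact: measurable_hits.
have mW t' : measurable_fun setT (W t').
  exact: measurable_fun_g_sigma (@history_measurable _) (mWh t').
have mhit t' : measurable_fun setT (fun w => (hit_at w t')%:R : R).
  apply: (measurable_fun_g_sigma (@history_measurable t'.+1)).
  exact: measurable_hit.
(* A hit halves [W], so [W t'] is [W t'.+1] plus half of [W t'] times the hit indicator. The
   additive form avoids subtracting extended reals before finiteness is known. *)
have WS t' :
  (\int[P]_w (W t'.+1 w)%:E + (2^-1)%:E * (pi0%:E * \int[P]_w (W t' w)%:E) <=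
    \int[P]_w (W t' w)%:E)%E.
  apply: (@le_trans _ _ (\int[P]_w (W t'.+1 w)%:E +
      \int[P]_w (2^-1 * (W t' w * (hit_at w t')%:R))%:E)%E).
    rewrite leeD2l//.
    under [leRHS]eq_integral do rewrite EFinM.
    rewrite ge0_integralZl//=; last 2 first.
    - by apply/measurable_EFinP; exact: measurable_funM.
    - by move=> w _; rewrite lee_fin mulr_ge0.
    rewrite lee_wpmul2l ?lee_fin// -ge0_integralZl//; last 2 first.
    - exact/measurable_EFinP.
    - by move=> w _; rewrite lee_fin.
    under eq_integral do rewrite muleC.
    under [leRHS]eq_integral do rewrite EFinM.
    apply: (@ge0_integral_sub_sigma_le _ _ _ P (history_gen t') (fun=> pi0%:E)
      (fun w => ((hit_at w t')%:R)%:E) (W t')) => //.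
    - exact: history_measurable.
    - exact/measurable_EFinP.
    - exact: hstep.
  rewrite -ge0_integralD//; last 4 first.
  - by move=> w _; rewrite lee_fin.
  - exact/measurable_EFinP.
  - by move=> w _; rewrite lee_fin !mulr_ge0.
  - apply/measurable_EFinP; apply: measurable_funM => //.
    exact: measurable_funM.
  rewrite le_eqVlt; apply/orP; left; apply/eqP.
  apply: eq_integral => w _; rewrite -EFinD; congr EFin.
  rewrite /W hitsS; case: (hit_at w t') => /=;
    last by rewrite addn0 mulr0 mulr0 addr0.
  by rewrite addn1 exprS mulr1 -mulrDl -[RHS]mul1r; congr (_ * _); field.
have Wexp t' : (\int[P]_w (W t' w)%:E <= ((1 - pi0 / 2) ^+ t')%:E)%E.
  elim: t' => [|t' IH].
    under eq_integral do rewrite /W /hits big_ord0 expr0.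
    by rewrite expr0 integral_cst// mul1e probability_le1.
  have I0 : (0 <= \int[P]_w (W t' w)%:E)%E.
    by apply: integral_ge0 => w _; rewrite lee_fin.
  have [a aE] : exists a, (\int[P]_w (W t' w)%:E)%E = a%:E.
    exists (fine (\int[P]_w (W t' w)%:E)%E); rewrite fineK//.
    by rewrite ge0_fin_numE//; exact: le_lt_trans IH (ltry _).
  move: IH (WS t'); rewrite aE lee_fin => IH.
  rewrite -!EFinM -leeBrDr// -EFinB => /le_trans; apply; rewrite lee_fin exprS.
  have : (1 - pi0 / 2) * a <= (1 - pi0 / 2) * (1 - pi0 / 2) ^+ t'.
    by rewrite ler_wpM2l//; lra.
  by lra.
have mhits := measurable_hits_lt_set m t.
have H : ((2^-1 ^+ m)%:E * P [set w | (hits_at w t < m)%N] <=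
    ((1 - pi0 / 2) ^+ t)%:E)%E.
  apply: le_trans (Wexp t); apply: markov_le => //= w wm.
  by rewrite /W !exprVn lef_pV2 ?posrE ?exprn_gt0// ler_eXn2l ?ltr1n// ltnW.
by rewrite EFinM -lee_pdivrMl ?exprn_gt0// -exprVn.
Qed.

(** Whether fewer than [m] hits have occurred is known before the next run. So that run multiplies
    the exponential either by 1 or, on a hit, by a factor of conditional mean at most 1. *)
Lemma early_noise_mgf (s kappa : R) (m t : nat) :
    (forall t A, <<s history_gen t >> A ->
      (\int[P]_(w in A) ((hit_at w t)%:R * expR (s * eps t w - kappa))%:E <=
       \int[P]_(w in A) ((hit_at w t)%:R)%:E)%E) ->
  (\int[P]_w (expR (\sum_(i < t)
     (early_at m w i)%:R * (s * eps i w - kappa)))%:E <= 1)%E.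
Proof.
move=> hstep.
pose W t w := expR (\sum_(i < t) (early_at m w i)%:R * (s * eps i w - kappa)).
have W0 t' w : 0 <= W t' w by rewrite expR_ge0.
have mWh t' : measurable_fun setT (W t' : Th t' -> R).
  apply: measurableT_comp => //; apply: measurable_sum => i.
  apply: measurable_funM; first exact: measurable_early.
  apply: measurable_funB => //; apply: measurable_funM => //.
  exact: measurable_eps_history.
have mW t' : measurable_fun setT (W t').
  exact: measurable_fun_g_sigma (@history_measurable _) (mWh t').
have mhit t' : measurable_fun setT (fun w => (hit_at w t')%:R : R).
  apply: (measurable_fun_g_sigma (@history_measurable t'.+1)).
  exact: measurable_hit.
pose lt t w : R := (hits_at w t < m)%:R.
have mlth t' : measurable_fun setT (lt t' : Th t' -> R).
  exact: measurable_hits_lt.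
have mlt t' : measurable_fun setT (lt t').
  exact: measurable_fun_g_sigma (@history_measurable _) (mlth t').
have mexp t' : measurable_fun setT (fun w => expR (s * eps t' w - kappa)).
  apply: measurableT_comp => //; apply: measurable_funB => //.
  exact: measurable_funM.
have mhe t' : measurable_fun setT (fun w =>
  (hit_at w t')%:R * expR (s * eps t' w - kappa)).
  exact: measurable_funM.
have mWl t' : measurable_fun setT (fun w => W t' w * lt t' w).
  exact: measurable_funM.
have earlyE t' w : (early_at m w t')%:R = lt t' w * (hit_at w t')%:R :> R.
  by rewrite /lt /early -natrM mulnb andbC.
have mrest t' : measurable_fun setT (fun w =>
  W t' w * (1 - (early_at m w t')%:R)).
  under eq_fun do rewrite earlyE.
  apply: measurable_funM => //; apply: measurable_funB => //.
  exact: measurable_funM.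
have rest0 t' w : 0 <= W t' w * (1 - (early_at m w t')%:R).
  by rewrite mulr_ge0// subr_ge0; case: (early _ _ _ _ _ _ _).
(* [W] is a supermartingale. *)
suff Wle t' : (\int[P]_w (W t' w)%:E <= 1)%E by exact: Wle.
elim: t' => [|t' IH].
  under eq_integral do rewrite /W big_ord0 expR0.
  by rewrite integral_cst// mul1e probability_le1.
apply: le_trans IH.
(* Separates the late or missed runs, which leave [W] unchanged, from the early ones, where
   [W t' * lt t'] is a weight determined by the history. *)
rewrite [leLHS](_ : _ = \int[P]_w (W t' w * (1 - (early_at m w t')%:R))%:E +
    \int[P]_w ((W t' w * lt t' w)%:E *
      ((hit_at w t')%:R * expR (s * eps t' w - kappa))%:E))%E; last first.
  rewrite -ge0_integralD//.
  - apply: eq_integral => w _; rewrite -EFinM -EFinD; congr EFin.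
    rewrite /W big_ord_recr/= expRD -/(W t' w) earlyE.
    rewrite /lt; case: (hit_at w t'); case: (_ < _)%N;
      rewrite /= ?(mul1r, mul0r,
      mulr1, mulr0, subr0, subrr, expR0, addr0, add0r)//.
  - by move=> w _; rewrite lee_fin.
  - exact/measurable_EFinP.
  - by move=> w _; rewrite -EFinM lee_fin !mulr_ge0 ?expR_ge0.
  - by under eq_fun do rewrite -EFinM; apply/measurable_EFinP;
    exact: measurable_funM.
(* The same splitting of [W t'] itself, with the exponential factor replaced by 1. *)
rewrite [leRHS](_ : _ = \int[P]_w (W t' w * (1 - (early_at m w t')%:R))%:E +
    \int[P]_w ((W t' w * lt t' w)%:E * ((hit_at w t')%:R)%:E))%E; last first.
  rewrite -ge0_integralD//.
  - apply: eq_integral => w _; rewrite -EFinM -EFinD; congr EFin.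
    by rewrite earlyE; lra.
  - by move=> w _; rewrite lee_fin.
  - exact/measurable_EFinP.
  - by move=> w _; rewrite -EFinM lee_fin !mulr_ge0 ?expR_ge0.
  - by under eq_fun do rewrite -EFinM; apply/measurable_EFinP;
    exact: measurable_funM.
rewrite leeD2l//.
apply: (@ge0_integral_sub_sigma_le _ _ _ P (history_gen t') _ _
  (fun w => W t' w * lt t' w)) => //.
- exact: history_measurable.
- exact/measurable_EFinP.
- exact/measurable_EFinP.
- exact: hstep.
- by move=> w; rewrite mulr_ge0.
- exact: measurable_funM.
Qed.

Lemma measurable_early_noise m t :
  measurable_fun setT (fun w => \sum_(i < t) (early_at m w i)%:R * eps i w).
Proof.
apply: (measurable_fun_g_sigma (@history_measurable t)).
apply: measurable_sum => i; apply: measurable_funM.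
  exact: measurable_early.
exact: measurable_eps_history.
Qed.

(** Chernoff's bound, with [b] a sign so that both tails share one proof. *)
Lemma early_noise_one_sided_tail (K delta b : R) (m t : nat) : 0 < K ->
  0 < delta ->
    b ^+ 2 = 1 ->
    (forall s t A, <<s history_gen t >> A ->
      (\int[P]_(w in A)
        ((hit_at w t)%:R * expR (s * eps t w - s ^+ 2 * K ^+ 2 / 2))%:E <=
       \int[P]_(w in A) ((hit_at w t)%:R)%:E)%E) ->
  (P [set w | (m%:R * delta <=
    b * \sum_(i < t) (early_at m w i)%:R * eps i w)%R] <=
   (expR (- (delta ^+ 2 / (2 * K ^+ 2))) ^+ m)%:E)%E.
Proof.
move=> K0 delta0 b1 hstep.
(* [s] minimizes the Chernoff exponent. *)
pose s := b * delta / K ^+ 2.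
pose kappa := s ^+ 2 * K ^+ 2 / 2.
have kappaE : kappa = delta ^+ 2 / (2 * K ^+ 2).
  rewrite /kappa /s expr_div_n exprMn b1 mul1r; field.
  by rewrite gt_eqF.
have kappa0 : 0 <= kappa.
  by rewrite kappaE divr_ge0 ?sqr_ge0// mulr_ge0// sqr_ge0.
have := early_noise_mgf m t (hstep s).
rewrite -/kappa => mgf.
have mS := measurable_early_noise m t.
have mA : measurable [set w |
    m%:R * delta <= b * \sum_(i < t) (early_at m w i)%:R * eps i w].
  rewrite -[X in measurable X]setTI; apply: measurable_fun_le => //.
  exact: measurable_funM.
have : ((expR kappa ^+ m)%:E * P [set w |
    (m%:R * delta <= b * \sum_(i < t) (early_at m w i)%:R * eps i w)%R] <= 1)%E.
  apply: le_trans mgf; apply: markov_le => //.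
  - move=> w /= Sw; rewrite -expRM_natl ler_expR.
    under eq_bigr do rewrite mulrBr mulrCA.
    rewrite sumrB -mulr_sumr -mulr_suml -natr_sum sum_early.
    (* At most [m] runs are early, so the correction is at most [m%:R * kappa] at any stage; this
       makes the tail uniform in [t]. *)
    have Cm : (minn (hits_at w t) m)%:R * kappa <= m%:R * kappa.
      by rewrite ler_wpM2r// ler_nat geq_minr.
    have : delta / K ^+ 2 * (m%:R * delta) <=
        delta / K ^+ 2 * (b * \sum_(i < t) (early_at m w i)%:R * eps i w).
      by rewrite ler_wpM2l// divr_ge0 ?sqr_ge0// ltW.
    (* The linear term is at least twice [m%:R * kappa], which leaves [m%:R * kappa] after the
       correction. *)
    rewrite (_ : delta / K ^+ 2 * (m%:R * delta) = m%:R * kappa *+ 2);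
      last first.
      by rewrite kappaE mulr2n; field; rewrite gt_eqF.
    rewrite (_ : delta / K ^+ 2 * (b * _) =
      s * \sum_(i < t) (early_at m w i)%:R * eps i w); last by rewrite /s; ring.
    by rewrite mulr2n; lra.
  - apply: measurableT_comp => //.
    under eq_fun do under eq_bigr do rewrite mulrBr mulrCA.
    under eq_fun do rewrite sumrB -mulr_sumr.
    apply: measurable_funB; first exact: measurable_funM.
    apply: (measurable_fun_g_sigma (@history_measurable t)).
    apply: measurable_sum => i; apply: measurable_funM => //.
    exact: measurable_early.
rewrite expRN exprVn kappaE => H.
by rewrite -[leRHS]mule1 lee_pdivlMl// exprn_gt0// expR_gt0.
Qed.

Lemma early_noise_tail (K delta : R) (m t : nat) : 0 < K -> 0 < delta ->
    (forall s t A, <<s history_gen t >> A ->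
      (\int[P]_(w in A)
        ((hit_at w t)%:R * expR (s * eps t w - s ^+ 2 * K ^+ 2 / 2))%:E <=
       \int[P]_(w in A) ((hit_at w t)%:R)%:E)%E) ->
  (P [set w | (m%:R * delta <=
    `|\sum_(i < t) (early_at m w i)%:R * eps i w|)%R] <=
   (2 * expR (- (delta ^+ 2 / (2 * K ^+ 2))) ^+ m)%:E)%E.
Proof.
move=> K0 delta0 hstep.
have mS := measurable_early_noise m t.
have mA b : measurable [set w |
    m%:R * delta <= b * \sum_(i < t) (early_at m w i)%:R * eps i w].
  rewrite -[X in measurable X]setTI; apply: measurable_fun_le => //.
  exact: measurable_funM.
have mN : measurable [set w |
    m%:R * delta <= `|\sum_(i < t) (early_at m w i)%:R * eps i w| ].
  rewrite -[X in measurable X]setTI; apply: measurable_fun_le => //.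
  exact: measurableT_comp.
apply: (@le_trans _ _ (P ([set w |
    (m%:R * delta <=
      1 * \sum_(i < t) (early_at m w i)%:R * eps i w)%R] `|` [set w |
    (m%:R * delta <= -1 * \sum_(i < t) (early_at m w i)%:R * eps i w)%R])))%E.
  apply: le_measure; rewrite ?inE//; first exact: measurableU.
  move=> w /=; rewrite mul1r mulN1r; case: ler0P => _ ?; by [left|right].
apply: le_trans; first exact: measureU2.
set u := expR _ ^+ m; rewrite (_ : 2 * u = u + u); last by rewrite mulr_natl.
rewrite EFinD leeD//; apply: early_noise_one_sided_tail => //.
  by rewrite expr1n.
by rewrite sqrrN expr1n.
Qed.

End sequential_bounds.

(** * Geometric decay, shrinking radii and real lower bounds *)

Lemma expr_small (R : realType) (rho e : R) : 0 <= rho < 1 -> 0 < e ->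
  exists n, forall k, (n <= k)%N -> rho ^+ k <= e.
Proof.
move=> /andP[rho0 rho1] e0.
have : rho ^+ n @[n --> \oo] --> 0 by apply: cvg_expr; rewrite ger0_norm.
move=> /cvgrPdist_le/(_ _ e0)[n _ nP]; exists n => k nk.
by have := nP k nk; rewrite /= sub0r normrN ger0_norm// exprn_ge0.
Qed.

Lemma radius_small (R : realType) (d : nat) (c xi eta : R) :
  (0 < d)%N -> 0 < c -> 0 < xi -> 0 < eta ->
  exists n, forall m, (n <= m)%N -> @Defs.radius R d c xi m <= eta.
Proof.
move=> d0 c0 xi0 eta0; pose a : R := xi / d%:R.
have a0 : 0 < a by rewrite divr_gt0// ltr0n.
(* The real sample size at which the radius equals [eta]. *)
pose u := (c / eta) `^ a^-1.
exists (Num.truncn u).+1 => m um.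
have {um}um : u <= m%:R.
  apply: ltW; apply: lt_le_trans (truncnS_gt _) _.
  by rewrite ler_nat.
have u0 : 0 < u by rewrite powR_gt0// divr_gt0.
have m0 : 0 < m%:R :> R by exact: lt_le_trans um.
rewrite /Defs.radius -/a powRN ler_pdivrMr ?powR_gt0//.
have : c / eta <= m%:R `^ a.
  rewrite (_ : c / eta = u `^ a).
    by rewrite ge0_ler_powR ?nnegrE// ltW.
  by rewrite -powRrM mulVf ?powRr1 ?gt_eqF// ltW// divr_gt0.
by rewrite ler_pdivrMr// mulrC.
Qed.

(** Turns a positive extended-real bound into a real one that can serve as a probability [pi0] in
    [few_hits_prob]. *)
Lemma lt0e_real (R : realType) (z : \bar R) : (0 < z)%E ->
  exists2 a : R, 0 < a <= 1 & (a%:E <= z)%E.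
Proof.
case: z => [a| |]//; last by exists 1; rewrite ?leey// ltr01 lexx.
rewrite lte_fin => a0; exists (Num.min a 1).
  by rewrite lt_min a0 ltr01 ge_min lexx orbT.
by rewrite lee_fin ge_min lexx.
Qed.

(** * Consistency of the estimator and the loss *)

Section consistency.
Context {R : realType} {dO : measure_display} {Omega : measurableType dO}.
Context {P : probability Omega R} {chi : finType} {d : nat}.
Hypothesis hd : (0 < d)%N.
Variable Y : set 'rV[R]_d.
Hypothesis hYmeas : measurable Y.
Variables (f : chi -> 'rV[R]_d -> R) (L1 : R).
Hypothesis hL1 : 0 < L1.
Hypothesis hflip : forall x, euclid_lipschitz Y L1 (f x).
Variables (sigma : chi -> 'rV[R]_d -> R) (L2 : R).
Hypothesis hL2 : 0 < L2.
Hypothesis hsigma : forall x y, Y y -> 0 < sigma x y.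
Hypothesis hsigmalip : forall x, euclid_lipschitz Y L2 (sigma x).
Variable N : chi -> 'rV[R]_d -> probability R R.
Hypothesis hN : forall x y B, Y y -> measurable B ->
  N x y B = normal_prob 0 (sigma x y) B.
Variables (xs : nat -> Omega -> chi) (ys : nat -> Omega -> 'rV[R]_d).
Variable eps : nat -> Omega -> R.
Hypothesis hpoints : random_points Y xs ys.
Variables (p : seq (run R chi d) -> chi -> R).
Variables (q : seq (run R chi d) -> chi -> 'rV[R]_d -> R).
Hypothesis hrule : sampling_rule Y xs ys eps f p q.
Hypothesis hsampled : sampled_from_rule P Y xs ys eps f p q.
Hypothesis hnoise : independent_errors P xs ys eps f N.
Variable lambda : R.
Hypothesis hlambda : 0 < lambda.
Hypothesis hdensity : forall t w x y,
  Y° y -> lambda < density xs ys eps f p q t w x y.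
Variables (c xi : R).
Hypothesis hc : 0 < c.
Hypothesis hxi : 0 < xi.

Local Notation obs := (observed xs ys eps f).
Local Notation rad m := (@Defs.radius R d c xi m).

Let meps t : measurable_fun setT (eps t).
Proof. by case: hnoise. Qed.

Let mf x : measurable_fun Y° (f x).
Proof.
apply: measurable_funS (measurable_fun_euclid_lipschitz hYmeas (hflip x)) => //.
exact: interior_subset.
Qed.

(** The weights sum to [m], so [f x y] can be moved inside the average. Each selected run lies
    within [rad m] of [y], and the Lipschitz condition bounds the bias. *)
Lemma sne_error w t x y (m := Psi Y c xi (obs w) t x y) : Y y -> (0 < m)%N ->
  `|sne Y c xi (obs w) t x y - f x y| <= L1 * rad m +
    m%:R^-1 * `|\sum_(i < t) (early Y (obs w) x y (rad m) m i)%:R * eps i w|.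
Proof.
move=> Yy m0; rewrite sneE// -/m.
pose E i : R := (early Y (obs w) x y (rad m) m i)%:R.
change (`|m%:R^-1 * (\sum_(i < t) E i * (obs w i).2) - f x y| <=
  L1 * rad m + m%:R^-1 * `|\sum_(i < t) E i * eps i w|).
have mR0 : 0 < m%:R :> R by rewrite ltr0n.
have sumE : \sum_(i < t) E i = m%:R.
  rewrite /E -natr_sum sum_early (minn_idPr _)//; exact: Psi_activated.
have -> : m%:R^-1 * (\sum_(i < t) E i * (obs w i).2) - f x y =
    m%:R^-1 * (\sum_(i < t) E i * (f (xs i w) (ys i w) - f x y)) +
    m%:R^-1 * \sum_(i < t) E i * eps i w.
  have -> : f x y = m%:R^-1 * \sum_(i < t) E i * f x y.
    by rewrite -mulr_suml sumE mulKf// gt_eqF.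
  rewrite -mulrBr -mulrDr -sumrB -big_split/=; congr (_ * _).
  apply: eq_bigr => i _; rewrite -mulr_suml sumE mulKf ?gt_eqF//.
  by rewrite /observed/=; ring.
apply: le_trans (ler_normD _ _) _.
rewrite !normrM ger0_norm ?invr_ge0//; apply: lerD => //.
rewrite ler_pdivrMl// -sumE mulr_suml; apply: le_trans (ler_norm_sum _ _ _) _.
apply: ler_sum => i _; rewrite normrM /E ger0_norm//.
rewrite /early; case Ei: (_ && _); last by rewrite !mul0r.
move: Ei => /andP[]; rewrite /hit/= => /and3P[/eqP xw yr /asboolP Yi] _.
rewrite !mul1r xw; apply: le_trans; first by apply: hflip => //;
  exact: interior_subset.
by rewrite ler_wpM2l// ltW.
Qed.

(** The bad event is that fewer than [m0] hits have occurred, or that the noise is large for some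
    sample size from [m0] on. All these sizes must be covered because [Psi] is random; each of the
    two causes costs at most [e / 2]. *)
Lemma sne_in_probability x y delta e : Y y -> closure Y° y -> 0 < delta ->
  0 < e ->
  exists T, forall t, (T <= t)%N -> exists B : set Omega,
    [/\ measurable B, (P B <= e%:E)%E
      & forall w, ~ B w -> `|sne Y c xi (obs w) t x y - f x y| < delta].
Proof.
move=> Yy clYy delta0 e0.
have YoY : Y° `<=` Y by exact: interior_subset.
(* Radius at most 1 keeps [sigma x] below [K] near [y]; radius at most [delta / 2 / L1] keeps the
   bias below [delta / 2]. *)
pose eta := Num.min 1 (delta / 2 / L1).
have eta0 : 0 < eta by rewrite lt_min ltr01 !divr_gt0.
have [n1 radn1] := radius_small hd hc hxi eta0.
pose K := sigma x y + L2.
have K0 : 0 < K by rewrite addr_gt0// hsigma.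
pose rho := expR (- ((delta / 2) ^+ 2 / (2 * K ^+ 2))).
have rho0 : 0 < rho by exact: expR_gt0.
have rho1 : rho < 1.
  by rewrite -expR0 ltr_expR oppr_lt0 divr_gt0 ?mulr_gt0 ?exprn_gt0 ?divr_gt0.
(* Chosen so that the geometric tail [2 * rho ^+ m0 / (1 - rho)] is at most [e / 2]. *)
have [n2 rhon2] : exists n, forall k, (n <= k)%N -> rho ^+ k <=
  e * (1 - rho) / 4.
  by apply: expr_small; [rewrite ltW|rewrite divr_gt0 ?mulr_gt0 ?subr_gt0].
pose m0 := maxn n1 (maxn n2 1).
have m00 : (0 < m0)%N by rewrite !leq_max leqnn !orbT.
have m0n1 : (n1 <= m0)%N by rewrite leq_max leqnn.
have m0n2 : (n2 <= m0)%N by rewrite !leq_max leqnn !orbT.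
have rad0 m : (0 < m)%N -> 0 < rad m.
  by move=> m1; apply: mulr_gt0 => //; apply: powR_gt0; rewrite ltr0n.
(* Here [y] must be in the closure of the interior: every ball around it then meets [Y°] in a
   nonempty open set, of positive volume. *)
have tnonempty : target Y y (rad m0) !=set0.
  have : nbhs y [set z | euclid_norm (z - y) < rad m0].
    apply: open_nbhs_nbhs; split; first exact: open_euclid_ball.
    by rewrite /= subrr euclid_norm0 rad0.
  by move=> /clYy[z [Yz rz]]; exists z.
have [pi0 /andP[pi00 pi01] pi0le] : exists2 a : R, 0 < a <= 1 &
    (a%:E <= lambda%:E * lebesgue_rV d (target Y y (rad m0)))%E.
  apply: lt0e_real; rewrite mule_gt0 ?lte_fin//.
  by apply: lebesgue_rV_open_gt0; first exact: open_target.
have [T hT] : exists n, forall k, (n <= k)%N ->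
    (1 - pi0 / 2) ^+ k <= e / 2 / 2 ^+ m0.
  by apply: expr_small; [lra|rewrite !divr_gt0 ?exprn_gt0].
exists T => t /hT few.
pose S m w := \sum_(i < t) (early Y (obs w) x y (rad m) m i)%:R * eps i w.
pose F i := [set w | (m0 + i)%:R * (delta / 2) <= `|S (m0 + i)%N w| ].
pose H := [set w | (hits Y (obs w) x y (rad m0) t < m0)%N].
have mF i : measurable (F i).
  rewrite -[X in measurable X]setTI; apply: measurable_fun_le => //.
  by apply: measurableT_comp => //; exact: measurable_early_noise.
have mH : measurable H.
  exact: (measurable_hits_lt_set hpoints meps mf).
(* A sample size never exceeds [t], so [t.+1] noise events suffice. *)
exists (H `|` \big[setU/set0]_(i < t.+1) F i); split.
- by apply: measurableU => //; exact: bigsetU_measurable.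
- apply: le_trans; first by apply: measureU2 => //; exact: bigsetU_measurable.
  rewrite (_ : e%:E = (e / 2)%:E + (e / 2)%:E)%E;
    last by rewrite -EFinD -splitr.
  apply: leeD.
    apply: le_trans.
      apply: (few_hits_prob hpoints meps mf (pi0 := pi0)) => [|t' A hA].
        by rewrite ltW.
      by apply: (hit_step hpoints meps mf x hrule hsampled hlambda) => //;
        exact: ltW.
    rewrite lee_fin mulrC -ler_pdivlMr ?exprn_gt0//.
  apply: le_trans; first exact: measure_bigsetU_le.
  apply: (@le_trans _ _ (\sum_(i < t.+1) (2 * rho ^+ (m0 + i))%:E)%E).
    apply: lee_sum => i _; apply: (early_noise_tail hpoints meps mf) => //.
      by rewrite divr_gt0.
    move=> s t' A hA.
    apply: (noise_step hpoints meps mf (N := N) (sigma := sigma x)) => //.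
    + by move=> u B [_ /YoY Yu]; exact: hN.
    + apply: measurable_funS (measurable_fun_euclid_lipschitz hYmeas (hsigmalip x)) => //.
      by move=> u [_ /YoY].
    + move=> u [/= ur /YoY Yu]; rewrite hsigma//=.
      have rad1 : rad (m0 + i) <= 1.
        apply: le_trans (radn1 _ _) _; first by rewrite (leq_trans m0n1)//
          leq_addr.
        by rewrite ge_min lexx.
      have u1 : L2 * euclid_norm (u - y) <= L2 * 1.
        by rewrite ler_wpM2l ?ltW// (lt_le_trans ur).
      have := hsigmalip x Yu Yy; have := ler_norm (sigma x u - sigma x y).
      rewrite /K; lra.
  rewrite sumEFin lee_fin -mulr_sumr.
  under eq_bigr do rewrite exprD.
  rewrite -mulr_sumr.
  have geo : (1 - rho) * \sum_(i < t.+1) rho ^+ i <= 1.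
    have := subrX1 rho t.+1; have : 0 <= rho ^+ t.+1 by rewrite exprn_ge0// ltW.
    lra.
  have rho1' : 0 < 1 - rho by rewrite subr_gt0.
  rewrite -(ler_pM2l rho1').
  have := rhon2 _ m0n2; have : 0 <= rho ^+ m0 by rewrite exprn_ge0// ltW.
  move: geo; set g := \sum_(i < _) _; set h := rho ^+ m0 => geo h0 hle.
  have : h * ((1 - rho) * g) <= h * 1 by rewrite ler_wpM2l.
  lra.
- move=> w nB.
  have Hw : (m0 <= hits Y (obs w) x y (rad m0) t)%N.
    by rewrite leqNgt; apply/negP => h; apply: nB; left.
  have := Psi_ge Hw; set m := Psi _ _ _ _ _ _ _ => m0m.
  have mm0 : (0 < m)%N by exact: leq_trans m0m.
  have mt : (m <= t)%N by apply:
    leq_trans (Psi_activated mm0) (hits_le _ _ _ _ _ _).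
  have Sw : `|S m w| < m%:R * (delta / 2).
    rewrite ltNge; apply/negP => h; apply: nB; right.
    rewrite -bigcup_mkord; exists (m - m0)%N => /=.
      by rewrite ltnS (leq_trans (leq_subr _ _)).
    by rewrite /F/= subnKC.
  apply: le_lt_trans (sne_error Yy mm0) _; rewrite -/m.
  have : m%:R^-1 * `|S m w| < delta / 2.
    by rewrite ltr_pdivrMl// ltr0n.
  have : L1 * rad m <= delta / 2.
    rewrite -ler_pdivlMl// mulrC; apply: le_trans (radn1 _ _) _.
      exact: leq_trans m0m.
    by rewrite ge_min lexx orbT.
  by rewrite /S; lra.
Qed.

(** * From consistent estimators to a vanishing loss *)

Variable dist : R -> R -> R.
Hypothesis hdist : is_metric dist.
Variable M : R.
Hypothesis hM : forall x x' y, Y y -> dist (f x y) (f x' y) <= M.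
Variable xstar : 'rV[R]_d -> chi.
Hypothesis hxstar : forall y, Y y -> is_argmin (fun x => f x y) (xstar y).
Variable xhat : nat -> 'rV[R]_d -> Omega -> chi.
Hypothesis hxhat : forall t y w, Y y ->
  is_argmin (fun x => sne Y c xi (obs w) t x y) (xhat t y w).

Lemma expected_loss_bounds t y : Y y ->
  (0 <= expected_loss P dist f xstar xhat t y <= M%:E)%E.
Proof.
move=> Yy; have [dist0 _ _ _] := hdist; rewrite /expected_loss unlock.
apply/andP; split; first by apply: integral_ge0 => w _; rewrite lee_fin.
apply: (@le_trans _ _ (\int[P]_w (cst M%:E w))%E).
  by apply: ge0_le_integral_nonmeasurable => w _; rewrite lee_fin// hM.
rewrite integral_cst// -[leRHS]mule1 lee_wpmul2l ?probability_le1//.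
by rewrite lee_fin (le_trans (dist0 (f (xstar y) y) (f (xstar y) y)))// hM.
Qed.

(* The metric [dist] need not be continuous, so closeness of [f xhat] to
   [f xstar] would not do: the gap above the minimum turns it into equality. *)
Lemma argmin_gap y : Y y -> exists2 delta : R, 0 < delta &
  forall g : chi -> R, (forall x, `|g x - f x y| < delta) ->
    forall x, is_argmin g x -> f x y = f (xstar y) y.
Proof.
move=> Yy.
(* The default 1 keeps the gap positive when every decision is optimal. *)
pose gap := \big[Num.min/1]_(x | f x y !=
  f (xstar y) y) (f x y - f (xstar y) y).
have gap0 : 0 < gap.
  apply: (big_ind (fun u : R => 0 < u)) => [//|u v u0 v0|x fx].
    by rewrite lt_min u0.
  by rewrite subr_gt0 lt_neqAle eq_sym fx hxstar.
exists (gap / 2) => [|g gf x gx]; first by rewrite divr_gt0.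
apply/eqP/negPn/negP => fx.
have : gap <= f x y - f (xstar y) y by apply: bigmin_le_cond.
have := gx (xstar y); have := gf x; have := gf (xstar y).
rewrite !ltr_norml; lra.
Qed.

(** Off the union of the bad events of all decisions the chosen decision is optimal and the loss is
    0; on this union the loss is at most [M]. *)
Lemma expected_loss_cvg y : Y y -> closure Y° y ->
  expected_loss P dist f xstar xhat t y @[t --> \oo] --> 0%E.
Proof.
move=> Yy clYy; have [dist0 dist_eq0 _ _] := hdist.
have [delta delta0 hdelta] := argmin_gap Yy.
have M0 : 0 <= M.
  by rewrite (le_trans (dist0 (f (xstar y) y) (f (xstar y) y)))// hM.
have fin_loss t : expected_loss P dist f xstar xhat t y \is a fin_num.
  have /andP[l0 lM] := expected_loss_bounds t Yy.
  by rewrite ge0_fin_numE// (le_lt_trans lM)// ltry.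
apply/fine_cvgP; split; first exact: nearW.
apply/cvgrPdist_le => e e0.
(* Makes [M * (#|chi|%:R * e')] at most [e]; adding 1 keeps both denominators positive. *)
pose e' := e / (M + 1) / (#|chi|%:R + 1).
have e'0 : 0 < e' by rewrite !divr_gt0// ?ltr_wpDl.
pose good t x (B : set Omega) := [/\ measurable B, (P B <= e'%:E)%E
  & forall w, ~ B w -> `|sne Y c xi (obs w) t x y - f x y| < delta].
have /(@choice _ _ (fun x n => forall t, (n <= t)%N -> exists B, good t x B))
    [T hT] : forall x, exists n, forall t, (n <= t)%N -> exists B, good t x B.
  by move=> x; exact: sne_in_probability.
exists (\max_x T x)%N => // t /= tT.
have /(@choice _ _ (good t))[B hB] : forall x, exists B, good t x B.
  move=> x; apply: hT; apply: leq_trans tT; exact: leq_bigmax.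
have mB x : measurable (B x) by have [] := hB x.
pose U := \big[setU/set0]_(x : chi) B x.
have mU : measurable U by exact: bigsetU_measurable.
have PU : (P U <= (#|chi|%:R * e')%:E)%E.
  apply: le_trans (measure_bigsetU_le _ _ mB) _.
  apply: (@le_trans _ _ (\sum_(x : chi) e'%:E)%E).
    by apply: lee_sum => x _; have [] := hB x.
  by rewrite sumEFin lee_fin sumr_const mulr_natl cardT.
have lossU : (expected_loss P dist f xstar xhat t y <= M%:E * P U)%E.
  rewrite /expected_loss unlock -integral_cst// [leRHS]integral_mkcond.
  apply: ge0_le_integral_nonmeasurable => w _; first by rewrite lee_fin.
  rewrite patchE; case: ifPn => [_|]; first by rewrite lee_fin hM.
  rewrite notin_setE => nUw; rewrite lee_fin.
  rewrite (hdelta (fun x => sne Y c xi (obs w) t x y) _ (xhat t y w))//.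
  - by have [_ ->] := dist_eq0 (f (xstar y) y) (f (xstar y) y).
  - move=> x; have [_ _] := hB x; apply; move: nUw; apply: contra_not => Bw.
    by rewrite /U -bigcup_seq; exists x => //=; rewrite mem_index_enum.
  - exact: hxhat.
have /andP[l0 _] := expected_loss_bounds t Yy.
rewrite sub0r normrN ger0_norm ?fine_ge0//.
rewrite -lee_fin fineK//; apply: (le_trans lossU).
apply: (@le_trans _ _ (M%:E * (#|chi|%:R * e')%:E)%E).
  by rewrite lee_wpmul2l// lee_fin.
rewrite -EFinM lee_fin /e'.
have -> : M * (#|chi|%:R * (e / (M + 1) / (#|chi|%:R + 1))) =
    e * (M / (M + 1)) * (#|chi|%:R / (#|chi|%:R + 1)).
  by field; rewrite !gt_eqF ?ltr_wpDl.
have h1 : M / (M + 1) <= 1 by rewrite ler_pdivrMr ?ltr_wpDl// mul1r lerDl.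
have h2 : #|chi|%:R / (#|chi|%:R + 1) <= 1 :> R.
  by rewrite ler_pdivrMr ?ltr_wpDl// mul1r lerDl.
have h10 : 0 <= M / (M + 1) by rewrite divr_ge0// addr_ge0.
have h20 : 0 <= #|chi|%:R / (#|chi|%:R + 1) :> R by rewrite divr_ge0// addr_ge0.
rewrite -[leRHS]mulr1; apply: ler_pM => //; first by rewrite mulr_ge0// ltW.
by rewrite -[leRHS]mulr1 ler_wpM2l// ltW.
Qed.

End consistency.

(** Sampled contexts lie in [Y°] and never approach a point outside [closure Y°]; [hPYclosure] makes
    such points negligible. [hdistbounded] provides the dominating constant, since a general metric
    can be unbounded on a bounded range. *)
Theorem proposition1 (R : realType) (dO : measure_display)
    (Omega : measurableType dO) (P : probability Omega R)
    (chi : finType) (d : nat) (hd : (0 < d)%N)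
    (Y : set 'rV[R]_d) (hYbounded : bounded_set Y) (hYmeas : measurable Y)
    (PY : probability 'rV[R]_d R) (hPY : PY Y = 1%E)
    (hPYclosure : PY (Y `\` closure Y°) = 0%E)
    (f : chi -> 'rV[R]_d -> R) (L1 : R) (hL1 : 0 < L1)
    (hfbounded : exists M : R, forall x y, Y y -> `|f x y| <= M)
    (hflip : forall x, euclid_lipschitz Y L1 (f x))
    (sigma : chi -> 'rV[R]_d -> R) (L2 : R) (hL2 : 0 < L2)
    (hsigma : forall x y, Y y -> 0 < sigma x y)
    (hsigmalip : forall x, euclid_lipschitz Y L2 (sigma x))
    (N : chi -> 'rV[R]_d -> probability R R)
    (hN : forall x y B, Y y -> measurable B ->
      N x y B = normal_prob 0 (sigma x y) B)
    (xs : nat -> Omega -> chi) (ys : nat -> Omega -> 'rV[R]_d)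
    (eps : nat -> Omega -> R)
    (hpoints : random_points Y xs ys)
    (p : seq (run R chi d) -> chi -> R)
    (q : seq (run R chi d) -> chi -> 'rV[R]_d -> R)
    (hrule : sampling_rule Y xs ys eps f p q)
    (hsampled : sampled_from_rule P Y xs ys eps f p q)
    (hnoise : independent_errors P xs ys eps f N)
    (lambda : R) (hlambda : 0 < lambda)
    (hdensity : forall t w x y, Y° y -> lambda < density xs ys eps f p q t w x y)
    (c xi : R) (hc : 0 < c) (hxi : 0 < xi)
    (dist : R -> R -> R) (hdist : is_metric dist)
    (hdistbounded : exists B : R, forall x x' y, Y y -> dist (f x y) (f x' y) <= B)
    (xstar : 'rV[R]_d -> chi)
    (hxstar : forall y, Y y -> is_argmin (fun x => f x y) (xstar y))
    (xhat : nat -> 'rV[R]_d -> Omega -> chi)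
    (hxhatmeas : forall t y x, Y y -> measurable [set w | xhat t y w = x])
    (hxhat : forall t y w, Y y ->
      is_argmin (fun x => sne Y c xi (observed xs ys eps f w) t x y)
                (xhat t y w)) :
  total_loss P Y PY dist f xstar xhat t @[t --> \oo] --> 0%E.
Proof.
have [M hM] := hdistbounded.
have mcl : measurable (closure Y°).
  rewrite -[closure _]setCK; apply: measurableC.
  by apply: open_measurable_rV; apply: closed_openC; exact: closed_closure.
apply: (@cvg_integral_nonmeasurable _ _ _ PY Y (Y `\` closure Y°) _ M) => //.
- exact: measurableD.
- by move=> t y Yy; exact: (expected_loss_bounds hdist hM).
- move=> y Yy /not_andP[//|/contrapT clYy].
  by apply: (expected_loss_cvg hd hYmeas hL1 hflip hL2 hsigma hsigmalip hN hpoints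
    hrule hsampled hnoise hlambda hdensity hc hxi hdist hM hxstar hxhat).
Qed.
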